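(* There is a randomized distributed algorithm in the CONGEST model which, for every $k$ and every connected $n$-node simple graph $G=(V,E)$ with edge connectivity $\lambda$ and minimum degree $\delta$ (with $\lambda$ and $\delta$ known to all nodes), solves the $k$-broadcast problem on $G$ with high probability in $$O\left(\frac{n\log n}{\delta}+\frac{k\log n}{\lambda}\right)$$ rounds.
   Context: CONGEST model: the network is an undirected, unweighted graph $G=(V,E)$ with $n=|V|$; each node $v$ has a unique identifier $\mathrm{ID}(v)\in[n^c]$ for some constant $c\ge 1$. Computation proceeds in synchronous rounds; in each round each node can send one $O(\log n)$-bit message to each of its neighbors. Local computation is free. Initially the topology of $G$ is unknown to the nodes. Complexity is the number of rounds. $k$-broadcast problem: there are $k$ messages of $O(\log n)$ bits each; each message is originally stored in some node of $G$, and a node may initially hold an arbitrary number of messages. The goal is that all nodes of $G$ know all $k$ messages. Edge connectivity $\lambda$: the size (number of edges) of a minimum edge cut of $G$. Minimum degree $\delta$: the minimum over nodes of the number of incident edges. ''With high probability'' means with probability $1-1/\mathrm{poly}(n)$. *)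

(* Defs.v *)
From HB Require Import structures.
From mathcomp Require Import all_boot all_order all_algebra.
From mathcomp Require Import reals exp.

Set Implicit Arguments.
Unset Strict Implicit.
Unset Printing Implicit Defensive.

Import Order.TTheory GRing.Theory Num.Theory.

Local Open Scope ring_scope.

(* A simple graph on the finite type V is a symmetric irreflexive relation. *)
Section Graph.
Variables (V : finType) (e : rel V).

Definition connected_graph : Prop := forall x y : V, connect e x y.

Definition degree (v : V) : nat := #|[pred w | e v w]|.

(* The default value #|V| never matters on a nonempty simple graph: degrees
   are smaller. *)
Definition min_degree : nat := \big[minn/#|V|]_(v : V) degree v.

(* Every edge between S and its complement is counted once, as the ordered
   pair directed out of S. *)
Definition cut_size (S : {set V}) : nat :=
  #|[pred p : V * V | [&& p.1 \in S, p.2 \notin S & e p.1 p.2]]|.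

(* The default value is an upper bound of every cut size; for 1 < #|V| the
   range is nonempty. *)
Definition edge_connectivity : nat :=
  \big[minn/(#|V| ^ 2)%N]_(S : {set V} | (S != set0) && (S != setT))
     cut_size S.

(* port v lists the neighbours of v, each exactly once; the p-th incident edge
   of v leads to the p-th entry.  The order is arbitrary and unrelated between
   the two ends of an edge. *)
Definition port_numbering (port : V -> seq V) : Prop :=
  forall v, uniq (port v) /\ forall w, (w \in port v) = e v w.

End Graph.

Definition bits := seq bool.

(* Everything a node knows before the first round, besides its private coins.
   In particular it is told neither n, nor k, nor the identifiers of its
   neighbours. *)
Record local_input := LocalInput {
  own_id : nat;
  own_degree : nat;
  known_lambda : nat;
  known_delta : nat;
  own_messages : seq bits
}.

(* A node draws all its coins at the start: a uniform bit string of length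
   coins i, where i is its local input.  send s p is the message put on port p,
   the empty string standing for silence; receive s l updates the state with
   the list l of incoming messages, in port order.  A node in a state s with
   output s = Some r has terminated and returned r. *)
Record algorithm := Algorithm {
  state : Type;
  coins : local_input -> nat;
  init : local_input -> bits -> state;
  send : state -> nat -> bits;
  receive : state -> seq bits -> state;
  output : state -> option (seq bits)
}.

Section Execution.
Variables (A : algorithm) (V : finType) (port : V -> seq V) (id : V -> nat).
Variables (msgs : V -> seq bits) (lambda delta : nat).

Definition input_of (v : V) : local_input :=
  LocalInput (id v) (size (port v)) lambda delta (msgs v).

Definition outcome := {dffun forall v : V, (coins A (input_of v)).-tuple bool}.

Definition message_sent (s : state A) (p : nat) : bits :=
  if output s is Some _ then [::] else send s p.

Definition update (s : state A) (inbox : seq bits) : state A :=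
  if output s is Some _ then s else receive s inbox.

(* The states after t rounds.  A message from w to v is put by w on the port
   of w that leads to v. *)
Fixpoint config (omega : outcome) (t : nat) (v : V) : state A :=
  if t is t'.+1 then
    update (config omega t' v)
      [seq message_sent (config omega t' w) (index v (port w)) | w <- port v]
  else init A (input_of v) (omega v).

(* In every execution and every round, all messages have at most b bits. *)
Definition respects_bandwidth (R : realType) (b : R) : Prop :=
  forall (omega : outcome) (t : nat) (v : V) (p : nat),
    (p < size (port v))%N ->
    (size (message_sent (config omega t v) p))%:R <= b.

Definition all_messages : seq bits := flatten [seq msgs v | v <- enum V].

(* After t rounds every node has terminated and returned exactly the messages
   initially present in the network (as a set, repetitions being ignored). *)
Definition broadcast_done (t : nat) (omega : outcome) : bool :=
  [forall v : V,
     if output (config omega t v) is Some r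
     then all [in all_messages] r && all [in r] all_messages
     else false].

Definition probability_done (R : realType) (t : nat) : R :=
  #|[pred omega : outcome | broadcast_done t omega]|%:R / #|{: outcome}|%:R.

End Execution.

(* Main.v *)
Require Import Defs.
From HB Require Import structures.
From mathcomp Require Import all_boot all_order all_algebra.
From mathcomp Require Import reals exp.
From mathcomp Require Import zify ring lra sequences.
From mathcomp Require boolp classical_sets functions topology normedtype.
From mathcomp Require derive realfun.

(* The nodes first flood the largest identifier M, together with the latest
   round in which some node updated its maximum; from the latter all nodes learn
   the eccentricity rho of the leader in the same round 5 rho + 2.  Since
   n <= M <= n^c, they then agree on a number L = 2^l of about
   lambda / (K log n) classes.  Every edge has a random colour, drawn by its end
   with the larger identifier, and every message a random tag, and a message is
   flooded first-in first-out along the edges of its class only.  A countdown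
   started anew by every busy node detects that all nodes are idle.

   If a class has diameter D and carries at most a messages, flooding it takes
   at most D + 2a + 2 rounds: a node that misses a message from distance r has
   received a new message in every round since round r.  With high probability
   - each class is connected: if every edge is absent with probability q, then
     f(q) = E[number of components - 1] satisfies q f'(q) >= (lambda / 2) f(q)
     by Russo's formula, because a graph with c > 1 components is crossed by at
     least lambda c / 2 edges; hence f(q) <= n q^(lambda / 2);
   - each class doubles every set X with 4 |X| <= delta, by a union bound over X
     and its closed neighbourhood; hence balls of radius O(log n) contain more
     than delta / 4 nodes, and D = O(n log n / delta);
   - each class carries k / L + O(log n) messages, by the exponential moment
     E[2^load] = (1 + 1/L)^k. *)

Set Implicit Arguments.
Unset Strict Implicit.
Unset Printing Implicit Defensive.

Import Order.TTheory GRing.Theory Num.Theory.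

(** * Balls, distances and flooding *)

Section Balls.
Variables (V : finType) (h : rel V).
Implicit Types (u v w : V) (X Y : {set V}) (r s : nat).

Definition neighbourhood X : {set V} := X :|: [set w | [exists v in X, h v w]].

Definition ball u r : {set V} := iter r neighbourhood [set u].

Lemma in_neighbourhood X w :
  reflect (exists2 v, v \in X & (v == w) || h v w) (w \in neighbourhood X).
Proof.
rewrite !inE; apply: (iffP orP) => [[wX | /exists_inP[v vX vw]] | [v vX]].
- by exists w; rewrite ?eqxx.
- by exists v; rewrite ?vw ?orbT.
case/orP => [/eqP<-|vw]; first by left.
by right; apply/exists_inP; exists v.
Qed.

Lemma ballS u r : ball u r.+1 = neighbourhood (ball u r).
Proof. by []. Qed.

Lemma ball_center u r : u \in ball u r.
Proof. by elim: r => [|r IH]; [rewrite inE | rewrite ballS inE IH]. Qed.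

Lemma sub_ballS u r : ball u r \subset ball u r.+1.
Proof. exact: subsetUl. Qed.

Lemma sub_ball u r s : r <= s -> ball u r \subset ball u s.
Proof.
elim: s => [|s IH]; first by rewrite leqn0 => /eqP->.
rewrite leq_eqVlt => /predU1P[->//|/IH rs].
exact: subset_trans rs (sub_ballS _ _).
Qed.

Lemma ball_step u v w r : v \in ball u r -> h v w -> w \in ball u r.+1.
Proof. by move=> vu vw; apply/in_neighbourhood; exists v; rewrite ?vw ?orbT. Qed.

Lemma ball_trans u v w r s :
  v \in ball u r -> w \in ball v s -> w \in ball u (r + s).
Proof.
move=> vu; elim: s w => [|s IH] w; first by rewrite inE addn0 => /eqP->.
rewrite ballS => /in_neighbourhood[x /IH xu xw]; rewrite addnS ballS.
by apply/in_neighbourhood; exists x.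
Qed.

Lemma ball_connect u v : connect h u v -> exists r, v \in ball u r.
Proof.
case/connectP => p; elim/last_ind: p v => [|p w IH] v /=.
  by move=> _ ->; exists 0; rewrite ball_center.
rewrite rcons_path last_rcons => /andP[/IH/(_ erefl)[r ur] hw ->].
by exists r.+1; apply: ball_step hw.
Qed.

Hypothesis hsym : symmetric h.

Lemma ball_sym u v r : (v \in ball u r) = (u \in ball v r).
Proof.
suff imp x y : y \in ball x r -> x \in ball y r by apply/idP/idP => /imp.
elim: r x y => [|r IH] x y; first by rewrite !inE eq_sym.
rewrite ballS => /in_neighbourhood[z /IH zx zy].
rewrite -add1n; apply: (ball_trans _ zx).
by apply/in_neighbourhood; exists y; [exact: set11 | rewrite eq_sym hsym].
Qed.

Lemma ball_neighbour u v r :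
  reflect (exists2 w, (w == v) || h v w & w \in ball u r) (v \in ball u r.+1).
Proof.
rewrite ballS; apply: (iffP (in_neighbourhood _ _)).
  by case=> w wu wv; exists w; rewrite // hsym.
by case=> w wu wv; exists w; rewrite // hsym.
Qed.

Hypothesis hconn : connected_graph h.

Definition dist u v : nat := ex_minn (ball_connect (hconn u v)).

Lemma distP u v r : (v \in ball u r) = (dist u v <= r).
Proof.
rewrite /dist; case: ex_minnP => s us mins; apply/idP/idP => [/mins//|].
by move=> /(sub_ball u)/subsetP->.
Qed.

Lemma distC u v : dist u v = dist v u.
Proof. by apply/eqP; rewrite eqn_leq -!distP ball_sym distP leqnn -ball_sym distP leqnn. Qed.

Lemma dist_triangle w u v : dist u v <= dist u w + dist w v.
Proof. by rewrite -distP; apply: (@ball_trans _ w); rewrite distP. Qed.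

Lemma dist0 u v : (dist u v == 0) = (u == v).
Proof. by rewrite -leqn0 -distP inE eq_sym. Qed.

Lemma dist_step u v w : (w == v) || h v w -> dist u v <= (dist u w).+1.
Proof.
move=> vw; rewrite -distP; apply/ball_neighbour; exists w => //.
by rewrite distP.
Qed.

Lemma dist_pred u v r :
  dist u v = r.+1 -> exists2 w, h v w & dist u w = r.
Proof.
move=> duv; have : v \in ball u r.+1 by rewrite distP duv.
case/ball_neighbour=> w wv; rewrite distP => wr.
have {}wv : h v w.
  by case/orP: wv => // /eqP wv; move: wr; rewrite wv duv ltnn.
exists w => //; apply/eqP; rewrite eqn_leq wr /=.
by have := @dist_step u v w; rewrite wv orbT duv ltnS => ->.
Qed.

Lemma dist_between u v r : r <= dist u v -> exists w, dist u w = r.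
Proof.
move: {2}(dist u v) (erefl (dist u v)) => s; elim: s v => [|s IH] v duv.
  by rewrite duv leqn0 => /eqP->; exists v.
rewrite duv leq_eqVlt => /predU1P[->|]; first by exists v.
by have [w _ dw] := dist_pred duv; rewrite ltnS -dw => /IH; apply.
Qed.

(** Every intermediate distance is attained, so each unit of radius up to [dist u v] adds a vertex
    to the ball around u. *)
Lemma dist_lt_card u v : dist u v < #|V|.
Proof.
have grow r : r <= dist u v -> r < #|ball u r|.
  elim: r => [|r IH] rd; first by rewrite cards1.
  apply: leq_ltn_trans (IH (ltnW rd)) _; apply: proper_card; apply/properP.
  split; first exact: sub_ballS.
  have [w dw] := dist_between rd.
  by exists w; rewrite distP dw // ltnn.
exact: leq_trans (grow _ (leqnn _)) (max_card _).
Qed.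

(* Balls of radius r around vertices that are 2r+1 apart are disjoint. *)
Lemma dist_of_ball_growth r g u v : 0 < g ->
  (forall w, g <= #|ball w r|) -> dist u v <= (2 * r + 1) * (#|V| %/ g + 1).
Proof.
move=> g0 big; set s := 2 * r + 1.
have step j : (exists v, s * j < dist u v) -> j * g <= #|ball u (s * j)|.
  elim: j => [|j IH] [x jx]; first by rewrite mul0n.
  have jx' : s * j + r + 1 <= dist u x by move: jx; rewrite /s; nia.
  (* The ball of radius r around w only occupies the distances from s j + 1 to s (j + 1) from u, so
     it contributes g new vertices to the j-th layer. *)
  have [w dw] := dist_between jx'.
  have disj : [disjoint ball u (s * j) & ball w r].
    apply/pred0P => y; apply/negP => /= /andP[]; rewrite !distP.
    move=> uy wy; have := dist_triangle y u w; rewrite (distC y w) dw; lia.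
  have sub : ball u (s * j) :|: ball w r \subset ball u (s * j.+1).
    rewrite subUset sub_ball /=; last by rewrite leq_mul2l leqnSn orbT.
    apply/subsetP => y; rewrite !distP => wy.
    have := dist_triangle w u y; rewrite dw /s; nia.
  apply: leq_trans (subset_leq_card sub).
  rewrite cardsU disjoint_setI0 // cards0 subn0 mulSn addnC leq_add //.
  by apply: IH; exists w; rewrite dw; lia.
rewrite leqNgt; apply/negP => lt.
have {}step := step _ (ex_intro _ v lt).
have := leq_trans step (max_card _).
by rewrite leqNgt addn1 ltn_ceil.
Qed.

(** While a ball has at most del / 4 vertices, one more step doubles it; so it has 2^r vertices
    unless it has already passed del / 4. *)
Lemma card_ball_expanding del r u :
  (forall X, X != set0 -> 4 * #|X| <= del -> 2 * #|X| <= #|neighbourhood X|) ->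
  del < 4 * 2 ^ r -> del < 4 * #|ball u r|.
Proof.
move=> expd; have : (2 ^ r <= #|ball u r|) || (del < 4 * #|ball u r|).
  elim: r => [|r]; first by rewrite cards1.
  have [small|lt _] := leqP (4 * #|ball u r|) del; last first.
    apply/orP; right; apply: leq_trans lt _.
    by rewrite leq_mul2l subset_leq_card ?orbT ?sub_ballS.
  rewrite orbF => le; apply/orP; left; rewrite expnS.
  apply: leq_trans (expd _ _ small); first by rewrite leq_mul2l le orbT.
  by apply/set0Pn; exists u; rewrite ball_center.
by case/orP => // le lt; apply: leq_trans lt _; rewrite leq_mul2l le orbT.
Qed.

End Balls.

Lemma dist_subrel (V : finType) (h e : rel V) (hc : connected_graph h)
    (ec : connected_graph e) (u v : V) :
  subrel h e -> dist ec u v <= dist hc u v.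
Proof.
move=> he; rewrite -distP.
suff sub r : ball h u r \subset ball e u r.
  by apply: (subsetP (sub _)); rewrite (distP hc).
elim: r => [|r IH]; first by [].
apply/subsetP => w /in_neighbourhood[x xr xw]; apply/in_neighbourhood.
exists x; first exact: (subsetP IH).
by case/orP: xw => [->//|/he->]; rewrite orbT.
Qed.

(* Store-and-forward flooding of a set of items: K t v is what v knows at time
   t, and Q t v lists what it has forwarded to all its neighbours.  An idle
   node has forwarded everything. *)
Section Flooding.
Variables (V : finType) (h : rel V) (T : eqType) (K Q : nat -> V -> seq T).
Hypothesis hsym : symmetric h.
Hypothesis K_uniq : forall t v, uniq (K t v).
Hypothesis Q_uniq : forall t v, uniq (Q t v).
Hypothesis K_mono : forall t v, {subset K t v <= K t.+1 v}.
Hypothesis Q_mono : forall t v, {subset Q t v <= Q t.+1 v}.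
Hypothesis QK : forall t v w, (v == w) || h v w -> {subset Q t v <= K t w}.
Hypothesis busy :
  forall t v, {subset K t v <= Q t v} \/ size (Q t v) < size (Q t.+1 v).

Lemma Q_size_mono t v : size (Q t v) <= size (Q t.+1 v).
Proof. exact: uniq_leq_size (Q_uniq _ _) (@Q_mono t v). Qed.

(* Induction on r: either all items from distance at most r have arrived, or
   the stream of distinct items was never interrupted. *)
Lemma flooding_progress r s v :
  (forall u, u \in ball h v r -> {subset K 0 u <= K (r + s) v})
  \/ s <= size (K (r + s) v).
Proof.
elim: r s v => [|r IH] s v.
  left=> u; rewrite inE => /eqP-> {u}.
  by elim: s => // s IH x /IH; exact: K_mono.
(* The dichotomy for w passes to what w has forwarded one round later: in each round w either has
   forwarded all it knows or forwards something new. *)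
have nbr w : (v == w) || h w v ->
    (forall u, u \in ball h w r -> {subset K 0 u <= Q (r.+1 + s) w})
    \/ s <= size (Q (r.+1 + s) w).
  move=> _; elim: s => [|s [IHs|IHs]]; first by right.
    by left=> u uw x /(IHs u uw) xQ; rewrite addnS; exact: Q_mono.
  have [sub|lt] := busy (r.+1 + s) w; last first.
    by right; rewrite addnS; apply: leq_ltn_trans lt.
  have [IH1|IH1] := IH s.+1 w.
    left=> u uw x /(IH1 u uw); rewrite addnS -addSn => /sub xQ.
    by rewrite addnS; exact: Q_mono.
  right; apply: leq_trans IH1 _; rewrite addnS -addSn.
  apply: leq_trans (uniq_leq_size (K_uniq _ _) sub) _.
  by rewrite addnS Q_size_mono.
have [lt|le] := ltnP (size (K (r.+1 + s) v)) s; last by right.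
left=> u uv x xu.
have : v \in ball h u r.+1 by rewrite ball_sym.
case/(ball_neighbour hsym) => w wv; rewrite ball_sym // => uw.
have wv' : (w == v) || h w v by rewrite hsym.
have [sub|big] := nbr w ltac:(by rewrite eq_sym).
  by apply: (QK wv'); apply: sub xu.
have := leq_trans big (uniq_leq_size (Q_uniq _ _) (@QK (r.+1 + s) w v wv')).
by rewrite leqNgt lt.
Qed.

Hypothesis K_origin : forall t v x, x \in K t v -> exists u, x \in K 0 u.
Variables (D a : nat).
Hypothesis D_diam : forall u v, u \in ball h v D.
Hypothesis K_size : forall t v, size (K t v) <= a.

(** No node can know a + 1 items, so by time D + a + 1 the stream was interrupted and everything has
    arrived everywhere. A node that stayed busy for a + 1 further rounds would have forwarded more
    than a items. *)
Lemma flooding_idle v : {subset K (D + 2 * a + 2) v <= Q (D + 2 * a + 2) v}.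
Proof.
have full j x u : x \in K 0 u -> x \in K (D + a.+1 + j) v.
  move=> xu; elim: j => [|j IH]; last by rewrite addnS; exact: K_mono.
  rewrite addn0; have [sub|] := flooding_progress D a.+1 v; first exact: sub xu.
  by rewrite ltnNge K_size.
have big j : {subset K (D + a.+1 + j) v <= Q (D + a.+1 + j) v}
    \/ j <= size (Q (D + a.+1 + j) v).
  elim: j => [|j IH]; first by right.
  (* Idleness persists from here on, because nothing is left to arrive. *)
  have idle : {subset K (D + a.+1 + j) v <= Q (D + a.+1 + j) v} ->
      {subset K (D + a.+1 + j.+1) v <= Q (D + a.+1 + j.+1) v}.
    move=> sub x /K_origin[u /(full j)/sub xQ]; rewrite addnS; exact: Q_mono.
  case: IH => [/idle|le]; first by left.
  have [/idle|lt] := busy (D + a.+1 + j) v; first by left.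
  by right; rewrite addnS; apply: leq_ltn_trans lt.
have -> : D + 2 * a + 2 = D + a.+1 + a.+1 by lia.
case: (big a.+1) => // lt.
have := uniq_leq_size (Q_uniq _ _) (@QK (D + a.+1 + a.+1) v v _).
by rewrite eqxx => /(_ isT)/(leq_trans lt)/leq_trans/(_ (K_size _ _)); rewrite ltnn.
Qed.

End Flooding.

(** * Electing a leader and detecting termination *)

Section Leader.
Variables (V : finType) (e : rel V) (id : V -> nat) (tp ch : nat -> V -> nat).
Hypotheses (esym : symmetric e) (econn : connected_graph e).
Hypothesis id_inj : injective id.
Hypothesis tp0 : forall v, tp 0 v = id v.
Hypothesis tp_ge : forall t v w, (w == v) || e v w -> tp t w <= tp t.+1 v.
Hypothesis tp_ex :
  forall t v, exists2 w, (w == v) || e v w & tp t.+1 v = tp t w.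
Hypothesis ch0 : forall v, ch 0 v = 0.
Hypothesis ch_ge : forall t v w, (w == v) || e v w -> ch t w <= ch t.+1 v.
Hypothesis ch_new : forall t v, tp t v < tp t.+1 v -> t < ch t.+1 v.
Hypothesis ch_ex : forall t v,
  (exists2 w, (w == v) || e v w & ch t.+1 v = ch t w)
  \/ (ch t.+1 v = t.+1 /\ tp t v < tp t.+1 v).

Local Notation d := (dist econn).

(** With [top_attained] this identifies [tp t v] as the largest identifier within distance t of
    v. *)
Lemma top_lower t u v : d u v <= t -> id u <= tp t v.
Proof.
elim: t v => [|t IH] v; rewrite -distP; first by rewrite inE tp0 => /eqP->.
case/(ball_neighbour esym) => w wv; rewrite (distP econn) => /IH le.
exact: leq_trans le (tp_ge _ wv).
Qed.

Lemma top_attained t v : exists2 u, d u v <= t & tp t v = id u.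
Proof.
elim: t v => [|t IH] v; first by exists v; rewrite ?tp0 // -distP ball_center.
have [w wv ->] := tp_ex t v; have [u uw ->] := IH w; exists u => //.
by rewrite -distP; apply/(ball_neighbour esym); exists w; rewrite ?(distP econn).
Qed.

Variable l : V.
Hypothesis l_max : forall u, id u <= id l.

Definition eccentricity := \max_v d l v.

Lemma top_leader t v : d l v <= t -> tp t v = id l.
Proof.
move=> lv; apply/eqP; rewrite eqn_leq top_lower // andbT.
by have [u _ ->] := top_attained t v.
Qed.

(** The maximal identifier reaches v in round [d l v], and the top of v cannot change afterwards. *)
Lemma change_le_ecc t v : ch t v <= eccentricity.
Proof.
elim: t v => [|t IH] v; first by rewrite ch0.
case: (ch_ex t v) => [[w _ ->]//|[-> lt]].
apply: leq_trans (leq_bigmax v); rewrite ltnNge; apply/negP => le.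
by move: lt; rewrite !top_leader ?ltnn //; apply: leqW.
Qed.

(** The news of a change travels one hop per round. *)
Lemma change_known s t u v :
  tp s u < tp s.+1 u -> s.+1 + d u v <= t -> s < ch t v.
Proof.
move=> lt; move: {2}(t - s.+1) (erefl (t - s.+1)) => r.
elim: r t v => [|r IH] t v tr le.
  have duv : d u v = 0 by lia.
  have -> : t = s.+1 by lia.
  by move/eqP: duv; rewrite dist0 => /eqP <-; exact: ch_new.
have [t' E] : exists t', t = t'.+1 by exists t.-1; lia.
rewrite E; have : v \in ball e u r.+1 by rewrite (distP econn); lia.
case/(ball_neighbour esym) => w wv; rewrite (distP econn) => uw.
by apply: leq_trans (ch_ge _ wv); apply: IH; lia.
Qed.

(* If a vertex at distance 2A+1 existed, A being the latest change known to v,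
   it would have heard of the local leader only after time A, and v would know
   about that change. *)
Lemma stable_ecc t v : 5 * ch t v + 2 <= t -> ch t v = eccentricity.
Proof.
set A := ch t v => le; have [l' l'v tpl'] := top_attained t v.
(* All that u hears before l' has a smaller identifier, since v would otherwise know it by time t.
   Hence u changes its top in round [d u l'], and v has learnt of this change. *)
have near u : d u l' + d u v <= t -> d u l' <= A.
  move=> uv; case E: (d u l') => [//|s]; apply: (@change_known _ _ u); last lia.
  have [x xu ->] := top_attained s u.
  apply: leq_trans (@top_lower s.+1 l' u _); last by rewrite (distC esym econn) E.
  rewrite ltn_neqAle; apply/andP; split.
    apply/eqP => /id_inj xl; move: xu; rewrite xl (distC esym econn) E; lia.
  rewrite -tpl'; apply: top_lower.
  have := dist_triangle econn u x v; lia.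
have vl' : d v l' <= A.
  by apply: near; rewrite (distC esym econn v l'); have /eqP-> : d v v == 0; rewrite ?dist0 ?addn0.
have small u : d u v <= 2 * A.
  rewrite leqNgt; apply/negP => lt.
  (* Here the threshold 5 A + 2 arises: [d u' l'] is at most 3 A + 1, and adding [d u' v] = 2 A + 1
     must not exceed t for [near] to apply to u'. It then yields [d u' v] at most 2 A. *)
  have [u'] : exists u', d v u' = 2 * A + 1.
    by apply: (@dist_between _ _ esym econn v u); rewrite (distC esym econn); lia.
  rewrite (distC esym econn) => du'.
  have t1 := dist_triangle econn v u' l'.
  have := near u' ltac:(lia).
  have := dist_triangle econn l' u' v; rewrite (distC esym econn l' v); lia.
have ll' : l = l'.
  apply: id_inj; apply/eqP; rewrite eqn_leq l_max andbT -tpl'.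
  by apply: top_lower; have := small l; lia.
apply/eqP; rewrite eqn_leq change_le_ecc /=; apply/bigmax_leqP => u _.
rewrite ll' (distC esym econn); apply: near.
have := small u; have := dist_triangle econn v u l'; lia.
Qed.

(** The right side does not depend on v: the local tests of all nodes succeed in the same round. *)
Lemma stableE t v : (5 * ch t v + 2 <= t) = (5 * eccentricity + 2 <= t).
Proof.
apply/idP/idP => [le|]; first by rewrite -(stable_ecc le).
by apply: leq_trans; rewrite leq_add2r leq_mul2l change_le_ecc.
Qed.

Lemma dist_le_ecc u v : d u v <= 2 * eccentricity.
Proof.
apply: leq_trans (dist_triangle econn l u v) _.
by rewrite mul2n -addnn leq_add ?(distC esym econn u) // /eccentricity (leq_bigmax).
Qed.

Lemma ecc_lt_card : eccentricity < #|V|.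
Proof.
have V0 : 0 < #|V| by apply/card_gt0P; exists l.
by rewrite -(prednK V0) ltnS; apply/bigmax_leqP => v _; rewrite -ltnS (prednK V0) dist_lt_card.
Qed.

End Leader.

(* Every active node resets its counter to r, which decays by one per round and
   per hop; hence a zero counter means that r rounds ago all nodes were idle. *)
Section Countdown.
Variables (V : finType) (e : rel V) (y : nat -> V -> nat) (act : nat -> V -> bool).
Variable r : nat.
Hypotheses (esym : symmetric e) (econn : connected_graph e).
Hypothesis r_diam : forall u v, dist econn u v < r.
Hypothesis y0 : forall v, y 0 v = r.
Hypothesis y_act : forall t v, act t v -> y t.+1 v = r.
Hypothesis y_dec : forall t v w, ~~ act t v -> (w == v) || e v w ->
  y t w <= (y t.+1 v).+1.
Hypothesis y_ex : forall t v, ~~ act t v ->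
  exists2 w, (w == v) || e v w & y t.+1 v = (y t w).-1.
Hypothesis act_mono :
  forall t, (forall v, ~~ act t v) -> forall v, ~~ act t.+1 v.

Lemma countdown_le t v : y t v <= r.
Proof.
elim: t v => [|t IH] v; first by rewrite y0.
have [/y_act->//|/y_ex[w _ ->]] := boolP (act t v).
exact: leq_trans (leq_pred _) (IH _).
Qed.

Lemma countdown_step t v w : (w == v) || e v w -> y t w <= (y t.+1 v).+1.
Proof.
move=> wv; have [/y_act->|a] := boolP (act t v); last exact: y_dec.
exact: leqW (countdown_le _ _).
Qed.

Lemma countdown0P t v :
  reflect (r <= t /\ forall w, ~~ act (t - r) w) (y t v == 0).
Proof.
apply: (iffP idP) => [/eqP yt0|[rt quiet]]; last first.
  (* Once no node is active, all counters lose one per round, starting from at most r. *)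
  suff : forall j w, y (t - r + j) w <= r - j.
    by move=> /(_ r v); rewrite subnK // subnn leqn0.
  have quiet' j : forall w, ~~ act (t - r + j) w.
    by elim: j => [|j IH]; rewrite ?addn0 // addnS; apply: act_mono.
  elim=> [|j IH] w; first by rewrite subn0 countdown_le.
  rewrite addnS; have [x _ ->] := y_ex (quiet' j w).
  have := IH x; lia.
have decay s j u w : w \in ball e u j -> y s u <= y (s + j) w + j.
  elim: j w => [|j IH] w; first by rewrite inE !addn0 => /eqP->.
  case/(ball_neighbour esym) => x xw /IH le.
  by have := @countdown_step (s + j) w x xw; rewrite (addnS s); lia.
have [rt|lt] := leqP r t; last first.
  by have := decay 0 t v v (ball_center _ _ _); rewrite y0 add0n yt0; lia.
split=> // u; apply/negP => /y_act yr.
(* A reset at u in round t - r reaches v, whose distance is at most r - 1, with r - 1 units of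
   decay; one unit would still be left at time t. *)
have := decay (t - r).+1 r.-1 u v; rewrite yr (distP econn).
have -> : (t - r).+1 + r.-1 = t by have := r_diam u v; lia.
have := r_diam u v; rewrite yt0; lia.
Qed.

End Countdown.

(** * The algorithm *)

Definition bits_of_nat (n : nat) : bits :=
  mkseq (fun i => odd (n %/ 2 ^ i)) (trunc_log 2 n).+1.

Definition nat_of_bits (s : bits) : nat :=
  foldr (fun (b : bool) x => b + x.*2) 0 s.

Lemma size_bits_of_nat n : size (bits_of_nat n) = (trunc_log 2 n).+1.
Proof. exact: size_mkseq. Qed.

Lemma bits_of_natK : cancel bits_of_nat nat_of_bits.
Proof.
have gen k n : n < 2 ^ k ->
    nat_of_bits (mkseq (fun i => odd (n %/ 2 ^ i)) k) = n.
  elim: k n => [|k IH] n; first by rewrite expn0 ltnS leqn0 => /eqP->.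
  rewrite expnS => lt; rewrite /mkseq /= divn1 -[1]addn0 iotaDl -map_comp.
  rewrite (eq_map (_ : _ =1 fun i => odd (n./2 %/ 2 ^ i))); last first.
    by move=> i /=; rewrite add1n expnS divnMA divn2.
  by rewrite IH ?odd_double_half //; lia.
by move=> n; apply: gen; rewrite trunc_log_ltn.
Qed.

Arguments bits_of_nat : simpl never.
Arguments nat_of_bits : simpl never.

(** A self-delimiting code: every bit is preceded by [true], and every string is closed by
    [false]. *)
Definition pack (l : seq bits) : bits :=
  flatten [seq rcons (flatten [seq [:: true; b] | b <- s]) false | s <- l].

Fixpoint unpack (acc s : bits) : seq bits :=
  match s with
  | true :: b :: s' => unpack (rcons acc b) s'
  | false :: s' => acc :: unpack [::] s'
  | _ => [::]
  end.

Lemma packK : cancel pack (unpack [::]).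
Proof.
elim=> // s l IH.
suff gen acc : unpack acc (pack (s :: l)) = (acc ++ s) :: l by rewrite gen.
rewrite /pack /= -/(pack l).
elim: s acc => [|b s IHs] acc /=; first by rewrite IH cats0.
by rewrite IHs cat_rcons.
Qed.

Lemma size_pack l : size (pack l) = \sum_(s <- l) (2 * size s).+1.
Proof.
rewrite size_flatten /shape -map_comp sumnE big_map; apply: eq_bigr => s _ /=.
rewrite size_rcons size_flatten /shape -map_comp sumnE big_map /=.
by congr _.+1; elim: s => [|b s IH]; rewrite ?big_nil ?big_cons //= IH; lia.
Qed.

Notation item := (bits * bits)%type.

Record message := Message {
  m_top : nat; m_chg : nat; m_ttl : nat; m_block : bits; m_item : option item
}.

Definition encode (m : message) : bits :=
  pack ([:: bits_of_nat (m_top m); bits_of_nat (m_chg m);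
            bits_of_nat (m_ttl m); m_block m]
        ++ if m_item m is Some x then [:: x.1; x.2] else [::]).

Definition decode (s : bits) : message :=
  match unpack [::] s with
  | [:: a; b; c; d; x; y] =>
      Message (nat_of_bits a) (nat_of_bits b) (nat_of_bits c) d (Some (x, y))
  | [:: a; b; c; d] =>
      Message (nat_of_bits a) (nat_of_bits b) (nat_of_bits c) d None
  | _ => Message 0 0 0 [::] None
  end.

Lemma encodeK : cancel encode decode.
Proof.
by case=> a b c d [[x y]|]; rewrite /decode /encode packK /= !bits_of_natK.
Qed.

Definition block (b p : nat) (s : bits) : bits := take b (drop (p * b) s).

Lemma maxn_bigmax_ex (T : eqType) (s : seq T) (f : T -> nat) v :
  exists2 w, (w == v) || (w \in s) & maxn (f v) (\max_(x <- s) f x) = f w.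
Proof.
elim: s => [|x s [w ws E]]; first by exists v; rewrite ?eqxx // big_nil maxn0.
rewrite big_cons maxnCA E; have [_|_] := leqP (f x) (f w); last first.
  by exists x; rewrite // inE eqxx orbT.
by exists w => //; rewrite inE orbCA ws orbT.
Qed.

Section Algorithm.
(* The number of classes is about lambda / (K log M), where M is the largest
   identifier, rounded to a power of two. *)
Variable K : nat.

Definition prefix_length (lam M : nat) : nat :=
  trunc_log 2 (lam %/ (K * (trunc_log 2 M).+1)).

(* [top] is the largest identifier heard of so far, [chg] the latest round in
   which some node is known to have updated its [top], and [ttl] the countdown
   that detects termination.  An item is a message with a random tag; items and
   edges fall into classes according to the first bits of their tag, resp. of
   their colour, and an item only travels along the edges of its class. *)
Record node := Node {
  local : local_input; rnd : bits; clock : nat; top : nat; chg : nat;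
  ttl : nat; colours : seq bits; log : seq item; sent : seq item
}.

(** The coins are drawn before the largest identifier, and with it the number of classes, is known.
    The blocks are therefore as long as any prefix that may be needed later. *)
Definition block_length (i : local_input) : nat := trunc_log 2 (known_lambda i).

Definition own_block (s : node) (p : nat) : bits :=
  block (block_length (local s)) p (rnd s).

(** The random string starts with one block per port, the colours; the blocks of the messages, their
    tags, follow. [undup] merges equal messages only if their tags agree as well. *)
Definition own_items (i : local_input) (w : bits) : seq item :=
  undup [seq (block (block_length i) (own_degree i + j) w,
              nth [::] (own_messages i) j) | j <- iota 0 (size (own_messages i))].

(** This is the test of [stable_ecc]: when it succeeds, [chg] is the eccentricity of the leader. *)
Definition ready (s : node) : bool := 5 * chg s + 2 <= clock s.

(** If a is the eccentricity of the leader, this strictly exceeds every distance, as the countdown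
    requires. *)
Definition span (a : nat) : nat := 2 * a + 2.

Definition class (s : node) (x : bits) : bits :=
  take (prefix_length (known_lambda (local s)) (top s)) x.

Definition next (s : node) (c : bits) : option item :=
  ohead [seq x <- log s | (class s x.1 == c) && (x \notin sent s)].

Definition active (s : node) : bool := has [predC sent s] (log s).

Definition message_at (s : node) (p : nat) : message :=
  Message (top s) (chg s) (ttl s) (own_block s p)
    (if ready s then next s (class s (nth [::] (colours s) p)) else None).

Definition start (i : local_input) (w : bits) : node :=
  Node i w 0 (own_id i) 0 (span 0) [::] (own_items i w) [::].

(** In the first round [m_top] is still the identifier of the neighbour, so both ends of an edge
    select the block of the end with the larger identifier. Once ready, a node sends one item per
    class and round, over all its edges of that class. *)
Definition step (s : node) (ms : seq message) : node :=
  let top' := maxn (top s) (\max_(m <- ms) m_top m) in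
  let chg' := maxn (if top s < top' then (clock s).+1 else 0)
                   (maxn (chg s) (\max_(m <- ms) m_chg m)) in
  Node (local s) (rnd s) (clock s).+1 top' chg'
    (if ready s then
       if active s then span (chg s)
       else (maxn (ttl s) (\max_(m <- ms) m_ttl m)).-1
     else span chg')
    (if clock s == 0 then
       [seq if own_id (local s) < m_top q.2 then m_block q.2
            else own_block s q.1
       | q <- zip (iota 0 (size ms)) ms]
     else colours s)
    (if ready s then
       log s ++ [seq x <- undup (pmap m_item ms) | x \notin log s]
     else log s)
    (if ready s then
       sent s ++ [seq x <- log s | next s (class s x.1) == Some x]
     else sent s).

Definition result (s : node) : option (seq bits) :=
  if ready s && (ttl s == 0) then Some (map snd (log s)) else None.

Definition broadcast : algorithm :=
  Algorithm
    (fun i => (own_degree i + size (own_messages i)) * block_length i)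
    start (fun s p => encode (message_at s p))
    (fun s l => step s (map decode l)) result.

Lemma nextP s c :
  if next s c is Some x
  then [/\ x \in log s, class s x.1 = c & x \notin sent s]
  else forall x, x \in log s -> class s x.1 = c -> x \in sent s.
Proof.
rewrite /next; case E: (filter _ _) => [|x l] /=.
  move=> x xl xc; apply/negPn/negP => xs.
  have : x \in [seq x <- log s | (class s x.1 == c) && (x \notin sent s)].
    by rewrite mem_filter xc eqxx xs.
  by rewrite E.
have : x \in x :: l by rewrite inE eqxx.
by rewrite -E mem_filter => /andP[/andP[/eqP]].
Qed.

Lemma activePn s : reflect {subset log s <= sent s} (~~ active s).
Proof.
rewrite /active -all_predC; apply: (iffP allP) => sub x /sub /=.
  by rewrite negbK.
by move=> ->.
Qed.

End Algorithm.

(** * Executions of the algorithm *)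

Lemma pmap_map (S T U : Type) (f : T -> option U) (g : S -> T) (s : seq S) :
  pmap f (map g s) = pmap (f \o g) s.
Proof. by elim: s => //= x s ->. Qed.

Section Run.
Variables (K : nat) (V : finType) (e : rel V) (port : V -> seq V) (id : V -> nat).
Variables (msgs : V -> seq bits) (lam del : nat).
Hypotheses (esym : symmetric e) (econn : connected_graph e).
Hypothesis eport : port_numbering e port.
Hypothesis id_inj : injective id.
Variable l : V.
Hypothesis l_max : forall u, id u <= id l.
Local Notation alg := (broadcast K).
Variable omega : outcome alg port id msgs lam del.

Local Notation inp := (input_of port id msgs lam del).
Local Notation conf := (@config alg V port id msgs lam del omega).

(** An idealised execution with unencoded messages, in which nodes never stop; [config_run] relates
    it to the real one. *)
Fixpoint run (t : nat) (v : V) : node :=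
  if t is t'.+1 then
    step K (run t' v)
      [seq message_at K (run t' w) (index v (port w)) | w <- port v]
  else start (inp v) (omega v).

Definition ended (s : node) : bool := isSome (result s).

Lemma mem_port v w : (w \in port v) = e v w.
Proof. by have [_] := eport v. Qed.

Lemma run_static t v : [/\ local (run t v) = inp v, rnd (run t v) = omega v
  & clock (run t v) = t].
Proof. by elim: t => [//|t [? ? IH]] /=; split; rewrite ?IH. Qed.

Lemma clock_run t v : clock (run t v) = t.
Proof. by have [] := run_static t v. Qed.

Lemma local_run t v : local (run t v) = inp v.
Proof. by have [] := run_static t v. Qed.

Local Notation tp t v := (top (run t v)).
Local Notation ch t v := (chg (run t v)).

Lemma tp0 v : tp 0 v = id v. Proof. by []. Qed.

Lemma tpS t v : tp t.+1 v = maxn (tp t v) (\max_(w <- port v) tp t w).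
Proof. by rewrite /= big_map. Qed.

Lemma chS t v : ch t.+1 v = maxn (if tp t v < tp t.+1 v then t.+1 else 0)
  (maxn (ch t v) (\max_(w <- port v) ch t w)).
Proof. by rewrite /= !big_map clock_run. Qed.

Lemma le_bigmax_port (f : V -> nat) v w :
  (w == v) || e v w -> f w <= maxn (f v) (\max_(x <- port v) f x).
Proof.
case/orP => [/eqP->|vw]; first exact: leq_maxl.
apply: leq_trans (leq_maxr _ _); apply: leq_bigmax_seq; rewrite ?mem_port //.
Qed.

Lemma tp_ge t v w : (w == v) || e v w -> tp t w <= tp t.+1 v.
Proof. by rewrite tpS => wv; apply: (le_bigmax_port (fun x => tp t x) wv). Qed.

Lemma bigmax_port_ex (f : V -> nat) v :
  exists2 w, (w == v) || e v w & maxn (f v) (\max_(x <- port v) f x) = f w.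
Proof.
by have [w wv E] := maxn_bigmax_ex (port v) f v; exists w; rewrite -?mem_port.
Qed.

Lemma tp_ex t v : exists2 w, (w == v) || e v w & tp t.+1 v = tp t w.
Proof. by rewrite tpS; apply: (bigmax_port_ex (fun x => tp t x)). Qed.

Lemma ch_ge t v w : (w == v) || e v w -> ch t w <= ch t.+1 v.
Proof. by rewrite chS => wv; rewrite leq_max (le_bigmax_port (fun x => ch t x) wv) orbT. Qed.

Lemma ch_new t v : tp t v < tp t.+1 v -> t < ch t.+1 v.
Proof. by rewrite chS => ->; rewrite leq_maxl. Qed.

Lemma ch_ex t v : (exists2 w, (w == v) || e v w & ch t.+1 v = ch t w)
  \/ (ch t.+1 v = t.+1 /\ tp t v < tp t.+1 v).
Proof.
rewrite chS; have [w wv ->] := bigmax_port_ex (fun x => ch t x) v.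
case: ifP => [lt|_]; last by left; exists w; rewrite ?max0n.
have [le|le] := leqP t.+1 (ch t w); first by left; exists w.
by right.
Qed.

Local Notation rho := (eccentricity econn l).
Let t0 := 5 * rho + 2.

Lemma ready_run t v : ready (run t v) = (t0 <= t).
Proof.
rewrite /ready clock_run.
exact: (stableE (tp := fun t v => tp t v) (ch := fun t v => ch t v) esym econn
  id_inj tp0 tp_ge tp_ex (fun _ => erefl) ch_ge ch_new ch_ex l_max).
Qed.

Lemma chg_le t v : chg (run t v) <= rho.
Proof.
exact: (change_le_ecc (tp := fun t v => tp t v) (ch := fun t v => ch t v) esym
  econn tp0 tp_ge tp_ex (fun _ => erefl) ch_ex l_max).
Qed.

Lemma chg_run t v : t0 <= t -> chg (run t v) = rho.
Proof.
move=> le; apply: (stable_ecc (tp := fun t v => tp t v)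
  (ch := fun t v => ch t v) esym econn id_inj tp0 tp_ge tp_ex
  (fun _ => erefl) ch_ge ch_new ch_ex l_max).
by apply: leq_trans le; rewrite leq_add2r leq_mul2l chg_le.
Qed.

Lemma top_run t v : t0 <= t -> top (run t v) = id l.
Proof.
move=> le; apply: (top_leader (tp := fun t v => tp t v) esym (econn := econn)
  tp0 tp_ge tp_ex l_max).
have : dist econn l v <= rho by rewrite /eccentricity leq_bigmax.
by move: le; rewrite /t0; lia.
Qed.

Local Notation st t v := (run (t0 + t) v).
Let plen := prefix_length K lam (id l).

Lemma class_st t v x : class K (st t v) x = take plen x.
Proof. by rewrite /class local_run top_run // leq_addr. Qed.

Lemma ready_st t v : ready (st t v).
Proof. by rewrite ready_run leq_addr. Qed.

Let b := trunc_log 2 lam.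

Definition edge_colour (v w : V) : bits :=
  if id v < id w then block b (index v (port w)) (omega w)
  else block b (index w (port v)) (omega v).

Lemma own_block_run t v p : own_block (run t v) p = block b p (omega v).
Proof. by have [E1 E2 _] := run_static t v; rewrite /own_block E1 E2. Qed.

Lemma colours_run t v w : 0 < t -> e v w ->
  nth [::] (colours (run t v)) (index w (port v)) = edge_colour v w.
Proof.
case: t => // t _ vw; elim: t => [|t IH]; last exact: IH.
rewrite /= size_map.
have lt : index w (port v) < size (port v) by rewrite index_mem mem_port.
rewrite (nth_map (0, message_at K (run 0 v) 0)); last first.
  by rewrite size_zip size_iota size_map minnn.
rewrite nth_zip ?size_iota ?size_map //= nth_iota // add0n.
rewrite (nth_map v) // nth_index ?mem_port //=.
Qed.

Lemma edge_colour_sym v w : edge_colour v w = edge_colour w v.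
Proof.
rewrite /edge_colour; case: ltngtP => // /id_inj ->; by [].
Qed.

Definition all_items : seq item :=
  flatten [seq own_items (inp v) (omega v) | v <- enum V].

Lemma log_start t v : t <= t0 -> log (run t v) = own_items (inp v) (omega v).
Proof.
elim: t => // t IH lt; rewrite /= ready_run leqNgt lt /=.
by apply: IH; apply: ltnW.
Qed.

Lemma sent_start t v : t <= t0 -> sent (run t v) = [::].
Proof.
elim: t => // t IH lt; rewrite /= ready_run leqNgt lt /=.
by apply: IH; apply: ltnW.
Qed.

Lemma item_received t v w : e v w ->
  m_item (message_at K (st t w) (index v (port w)))
  = next K (st t w) (take plen (edge_colour v w)).
Proof.
move=> vw; rewrite /= ready_st colours_run ?class_st 1?edge_colour_sym //.
  by rewrite /t0; lia.
by rewrite esym.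
Qed.

Lemma log_st t v x : x \in log (st t.+1 v) = (x \in log (st t v))
  || [exists w, e v w && (next K (st t w) (take plen (edge_colour v w)) == Some x)].
Proof.
rewrite addnS /= ready_st mem_cat mem_filter mem_undup.
case: (boolP (x \in log _)) => //= _; rewrite pmap_map mem_pmap.
apply/mapP/existsP => [[w]|[w /andP[vw /eqP E]]]; last first.
  by exists w; [rewrite mem_port | rewrite -E -item_received].
rewrite mem_port => vw E; exists w.
by rewrite vw -item_received // E /= eqxx.
Qed.

Lemma sent_st t v : sent (st t.+1 v) = sent (st t v) ++
  [seq x <- log (st t v) | next K (st t v) (take plen x.1) == Some x].
Proof.
rewrite addnS /= ready_st; congr (_ ++ _).
by apply: eq_filter => x; rewrite class_st.
Qed.

Lemma log_mono t v : {subset log (st t v) <= log (st t.+1 v)}.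
Proof. by move=> x xl; rewrite log_st xl. Qed.

Lemma sent_mono t v : {subset sent (st t v) <= sent (st t.+1 v)}.
Proof. by move=> x xl; rewrite sent_st mem_cat xl. Qed.

Lemma log_uniq t v : uniq (log (run t v)).
Proof.
elim: t => [|t IH]; first exact: undup_uniq.
rewrite /=; case: ifP => _ //; rewrite cat_uniq IH /= filter_uniq ?undup_uniq //.
by rewrite andbT; apply/hasPn => x; rewrite mem_filter => /andP[].
Qed.

Lemma sent_log t v : {subset sent (st t v) <= log (st t v)}.
Proof.
elim: t => [|t IH] x; first by rewrite sent_start ?addn0.
rewrite sent_st mem_cat mem_filter => /orP[/IH|/andP[_]]; exact: log_mono.
Qed.

Lemma sent_uniq t v : uniq (sent (st t v)).
Proof.
elim: t => [|t IH]; first by rewrite sent_start ?addn0.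
rewrite sent_st cat_uniq IH filter_uniq ?log_uniq //= andbT.
apply/hasPn => x; rewrite mem_filter => /andP[/eqP E _].
by have := nextP K (st t v) (take plen x.1); rewrite E => -[].
Qed.

Lemma sent_step t v x c : next K (st t v) c = Some x -> x \in sent (st t.+1 v).
Proof.
move=> E; rewrite sent_st mem_cat mem_filter.
have := nextP K (st t v) c; rewrite E class_st => -[-> xc _].
by rewrite xc E eqxx orbT.
Qed.

(** An item enters [sent] in the round in which it is the next one of its class, and it then goes
    over every edge of this class. *)
Lemma sent_received t v w x : e v w -> x \in sent (st t v) ->
  take plen x.1 = take plen (edge_colour v w) -> x \in log (st t w).
Proof.
move=> vw + xc; elim: t => [|t IH]; first by rewrite sent_start ?addn0.
rewrite sent_st mem_cat => /orP[/IH|]; first exact: log_mono.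
rewrite mem_filter => /andP[/eqP E _]; rewrite log_st; apply/orP; right.
by apply/existsP; exists v; rewrite esym vw -edge_colour_sym -xc E eqxx.
Qed.

Lemma log_all t v x : x \in log (run t v) -> x \in all_items.
Proof.
have [lt|le] := leqP t t0.
  rewrite log_start // => xv; apply/flattenP.
  by exists (own_items (inp v) (omega v)) => //; apply/mapP; exists v; rewrite ?mem_enum.
rewrite -(subnKC (ltnW le)); elim: (t - t0) v x => [|j IH] v x.
  rewrite addn0 log_start // => xv; apply/flattenP.
  by exists (own_items (inp v) (omega v)) => //; apply/mapP; exists v; rewrite ?mem_enum.
rewrite log_st => /orP[/IH//|/existsP[w /andP[_ /eqP E]]]; apply: (IH w).
by have := nextP K (st j w) (take plen (edge_colour v w)); rewrite E => -[].
Qed.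

Lemma all_items_tags x : x \in all_items -> size x.1 = b.
Proof.
case/flattenP => s /mapP[u _ ->]; rewrite mem_undup => /mapP[j].
rewrite mem_iota add0n => /= jlt -> /=.
rewrite /block size_takel // size_drop size_tuple -mulnBl.
by rewrite leq_pmull // subn_gt0 ltn_add2l.
Qed.

Lemma all_items_messages x : x \in all_items ->
  exists2 u, x.2 \in msgs u & size x.1 <= b.
Proof.
move=> xa; case/flattenP: (xa) => s /mapP[u _ ->]; rewrite mem_undup => /mapP[j].
rewrite mem_iota add0n => /= jlt E; exists u; last by rewrite all_items_tags.
by rewrite E /= mem_nth.
Qed.

Lemma messages_all_items u z : z \in msgs u -> exists2 x, x \in all_items & x.2 = z.
Proof.
move=> zu; pose j := index z (msgs u).
exists (block b (size (port u) + j) (omega u), nth [::] (msgs u) j).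
  apply/flattenP; exists (own_items (inp u) (omega u)).
    by apply/mapP; exists u; rewrite ?mem_enum.
  by rewrite mem_undup; apply/mapP; exists j; rewrite // mem_iota index_mem.
by rewrite /= nth_index.
Qed.

Let idle t := forall v, ~~ active (st t v).

Lemma idle_next t v c : ~~ active (st t v) -> next K (st t v) c = None.
Proof.
move/activePn => sub; have := nextP K (st t v) c.
by case: (next _ _ _) => // x [/sub->].
Qed.

Lemma idle_step t : idle t -> idle t.+1.
Proof.
move=> q v; apply/activePn => x; rewrite log_st => /orP[xl|/existsP[w]].
  by apply: sent_mono; move/activePn: (q v) => /(_ x); apply.
by rewrite idle_next // andbF.
Qed.

(** Before round [t0] the counter just follows [chg], which equals the eccentricity at every node in
    round [t0]; so all countdowns start from the same value. *)
Lemma ttl_start v : ttl (st 0 v) = span rho.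
Proof.
have : t0 = (5 * rho + 1).+1 by rewrite /t0; lia.
rewrite addn0; move E : t0 => t tS; rewrite tS.
have -> : ttl (run (5 * rho + 1).+1 v) = span (chg (run (5 * rho + 1).+1 v)).
  by rewrite /= ready_run E tS ltnn.
by rewrite chg_run // E tS.
Qed.

Lemma ttl_st t v : ttl (st t.+1 v) = if active (st t v) then span rho
  else (maxn (ttl (st t v)) (\max_(w <- port v) ttl (st t w))).-1.
Proof. by rewrite addnS /= ready_st chg_run ?leq_addr // big_map. Qed.

Lemma ttl_zero t v :
  reflect (span rho <= t /\ idle (t - span rho)) (ttl (st t v) == 0).
Proof.
apply: (countdown0P (y := fun t v => ttl (st t v))
  (act := fun t v => active (st t v)) esym (econn := econn)).
- by move=> u w; have := dist_le_ecc esym econn l u w; rewrite /span; lia.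
- exact: ttl_start.
- by move=> s u a; rewrite ttl_st a.
- move=> s u w /negPf a wu; rewrite ttl_st a.
  by have := le_bigmax_port (fun x => ttl (st s x)) wu; lia.
- move=> s u /negPf a; rewrite ttl_st a.
  by have [w wu ->] := bigmax_port_ex (fun x => ttl (st s x)) u; exists w.
- by move=> s q; apply: idle_step.
Qed.

(** The condition does not depend on v, hence all nodes terminate in the same round. *)
Lemma endedP t v :
  reflect (exists2 s, t = t0 + (s + span rho) & idle s) (ended (run t v)).
Proof.
rewrite /ended /result ready_run.
have [le|lt] := leqP t0 t; last by constructor => -[s E _]; move: lt; rewrite E; lia.
rewrite -(subnKC le) /= (fun_if isSome) /=.
case: (ttl_zero (t - t0) v) => q; constructor.
  by case: q => le' q; exists (t - t0 - span rho) => //; lia.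
by case=> s E q'; apply: q; split; [lia | have -> : t - t0 - span rho = s by lia].
Qed.

Lemma ended_all t v w : ended (run t v) -> ended (run t w).
Proof. by move/endedP => H; apply/endedP. Qed.

(** As the nodes stop simultaneously, the silence of a stopped node is never read by a running one.
    The real execution thus follows [run] up to the common end and is frozen afterwards. *)
Lemma config_run t :
  (forall v, conf t v = run t v) /\ (forall s v, s < t -> ~~ ended (run s v))
  \/ exists2 s, s < t & forall v, ended (run s v) /\ conf t v = run s v.
Proof.
elim: t => [|t [[IH no]|[s lt IH]]]; first by left.
  have [en|no'] := boolP (ended (run t l)).
    right; exists t => // v; have ev := ended_all v en; split=> //.
    by move: ev; rewrite /= IH /ended /update /=; case: (result _).
  left; split=> [v|s v]; last first.
    rewrite ltnS leq_eqVlt => /predU1P[->|/no//].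
    by apply: contra no' => /ended_all.
  have none w : result (run t w) = None.
    by have : ~~ ended (run t w) by [apply: contra no' => /ended_all];
      rewrite /ended; case: (result _).
  rewrite /= IH /update /= none -map_comp; congr step; apply: eq_map => w /=.
  by rewrite IH /message_sent /= none encodeK.
right; exists s => [|v]; first exact: ltnW.
have [ev E] := IH v; split=> //.
by rewrite /= E /update /=; move: ev; rewrite /ended; case: (result _).
Qed.

Lemma ttl_le t v : ttl (run t v) <= span rho.
Proof.
have mono x : x <= rho -> span x <= span rho by rewrite /span; lia.
elim: t v => [|t IH] v; first exact: mono.
rewrite [ttl _]/=; case: ifP => _; last exact: mono (chg_le t.+1 v).
case: ifP => _; first exact: mono (chg_le t v).
apply: leq_trans (leq_pred _) _; rewrite big_map geq_max IH /=.
by apply/bigmax_leqP_seq => w _ _; exact: IH.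
Qed.

(** At all times [top] is at most the identifier of the leader, [chg] is less than n and [ttl] is at
    most 2 n; an item consists of b tag bits and an original message. The code doubles all
    lengths. *)
Lemma encode_le mu t v p : (forall u z, z \in msgs u -> size z <= mu) ->
  size (encode (message_at K (run t v) p))
    <= 2 * (trunc_log 2 (id l) + trunc_log 2 #|V| + trunc_log 2 (2 * #|V|)
            + 2 * b + mu) + 12.
Proof.
move=> hmu; rewrite /encode size_pack big_cat !big_cons big_nil !size_bits_of_nat /= own_block_run.
have lb : size (block b p (omega v)) <= b by rewrite /block size_take_min geq_minl.
have r_n := ecc_lt_card esym econn l.
have tlog x y : x <= y -> trunc_log 2 x <= trunc_log 2 y.
  exact: leq_trunc_log.
have l1 : trunc_log 2 (top (run t v)) <= trunc_log 2 (id l).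
  apply: tlog; have [u _ ->] := top_attained (tp := fun t v => tp t v) esym econn tp0 tp_ex t v.
  exact: l_max.
have l2 : trunc_log 2 (chg (run t v)) <= trunc_log 2 #|V|.
  by apply: tlog; have := chg_le t v; lia.
have l3 : trunc_log 2 (ttl (run t v)) <= trunc_log 2 (2 * #|V|).
  by apply: tlog; have := ttl_le t v; rewrite /span; lia.
set o := if _ then _ else _.
have l4 : \sum_(s <- if o is Some x then [:: x.1; x.2] else [::]) (2 * size s).+1
    <= 2 * b + 2 * mu + 2.
  case E: o => [x|]; last by rewrite big_nil.
  rewrite !big_cons big_nil; suff [u xu] : exists2 u, x.2 \in msgs u & size x.1 <= b.
    have /= := hmu _ _ xu; move: (size x.1) (size x.2) => i j; lia.
  apply: all_items_messages; apply: (@log_all t v).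
  move: E; rewrite /o; case: ifP => // _ E.
  have := nextP K (run t v)
    (class K (run t v) (nth [::] (colours (run t v)) p)).
  by rewrite E => -[].
apply: leq_trans (leq_add (leqnn _) l4) _.
have arith x1 x2 x3 x4 y1 y2 y3 c : x1 <= y1 -> x2 <= y2 -> x3 <= y3 -> x4 <= c ->
    (2 * x1.+1).+1 + ((2 * x2.+1).+1 + ((2 * x3.+1).+1 + ((2 * x4).+1 + 0)))
    + (2 * c + 2 * mu + 2) <= 2 * (y1 + y2 + y3 + 2 * c + mu) + 12 by lia.
exact: arith.
Qed.

Lemma message_sent_le mu t v p : (forall u z, z \in msgs u -> size z <= mu) ->
  size (message_sent (conf t v) p)
    <= 2 * (trunc_log 2 (id l) + trunc_log 2 #|V| + trunc_log 2 (2 * #|V|)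
            + 2 * b + mu) + 12.
Proof.
move=> hmu; rewrite /message_sent /=.
case: (config_run t) => [[-> _]|[s _ IH]].
  by case: (result _) => // ; exact: encode_le.
by have [+ ->] := IH v; rewrite /ended; case: (result _).
Qed.

(** * Flooding in all classes simultaneously *)

Section Classes.
Variables (D a : nat).
Definition class_graph (c : bits) : rel V :=
  fun v w => e v w && (take plen (edge_colour v w) == c).

Hypothesis tag_size : plen <= b.
Hypothesis class_ball : forall c, size c = plen ->
  forall u v, u \in ball (class_graph c) v D.
Hypothesis class_load : forall c, size c = plen ->
  size [seq x <- all_items | take plen x.1 == c] <= a.

Lemma class_size x t v : x \in log (run t v) -> size (take plen x.1) = plen.
Proof. by move/log_all/all_items_tags => E; rewrite size_takel // E. Qed.

Lemma class_graph_sym c : symmetric (class_graph c).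
Proof. by move=> v w; rewrite /class_graph esym edge_colour_sym. Qed.

(** Items of different classes share no edges and do not delay each other, so [flooding_idle]
    applies to each class by itself, with logs and sent items restricted to it. *)
Lemma idle_bound : idle (D + 2 * a + 2).
Proof.
move=> v; apply/activePn => x xl; set c := take plen x.1.
have cs : size c = plen by apply: class_size xl.
pose restr (f : node -> seq item) t v := [seq x <- f (st t v) | take plen x.1 == c].
have := @flooding_idle _ (class_graph c) _ (restr log) (restr sent)
  (class_graph_sym c) _ _ _ _ _ _ _ D a (class_ball cs) _ v x.
rewrite !mem_filter eqxx /= => /(_ _ _ _ _ _ _ _ _ xl); apply.
- by move=> t w; rewrite filter_uniq ?log_uniq.
- by move=> t w; rewrite filter_uniq ?sent_uniq.
- by move=> t w y; rewrite !mem_filter => /andP[->] /log_mono.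
- by move=> t w y; rewrite !mem_filter => /andP[->] /sent_mono.
- move=> t u w uw y; rewrite !mem_filter => /andP[/eqP yc ys]; rewrite yc eqxx /=.
  case/orP: uw => [/eqP<-|/andP[uw /eqP uwc]]; first exact: sent_log.
  by apply: (sent_received uw ys); rewrite yc uwc.
(* Either w has no unsent item of class c, or the next one is sent in this round and lengthens the
   restricted list. *)
- move=> t w; have := nextP K (st t w) c.
  case E: (next _ _ _) => [y|] => [[yl]|none]; last first.
    left=> y; rewrite !mem_filter => /andP[yc yl]; rewrite yc /=.
    by apply: none; rewrite ?class_st //; apply/eqP.
  rewrite class_st => yc ys; right.
  have : uniq (y :: restr sent t w).
    by rewrite /= filter_uniq ?sent_uniq // mem_filter (negPf ys) andbF.
  move=> uq; apply: (uniq_leq_size uq) => z; rewrite inE !mem_filter.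
  by case/predU1P => [->|/andP[->] /sent_mono//]; rewrite (sent_step E) yc eqxx.
- move=> t w y; rewrite mem_filter => /andP[yc yl].
  have /flattenP[s /mapP[u _ ->] yu] := log_all yl.
  by exists u; rewrite mem_filter yc addn0 log_start.
- move=> t w; apply: leq_trans (class_load cs).
  apply: uniq_leq_size; first by rewrite filter_uniq ?log_uniq.
  by move=> y; rewrite !mem_filter => /andP[->] /log_all.
Qed.

(** When all nodes are idle, whoever knows an item has passed it on; so the item is known along
    every path of its class graph that starts at its origin. *)
Lemma idle_complete t v : idle t -> log (st t v) =i all_items.
Proof.
move=> q x; apply/idP/idP => [/log_all//|xa].
have /flattenP[s /mapP[u _ ->] xu] := xa.
set c := take plen x.1.
have cs : size c = plen by rewrite /c size_takel // all_items_tags.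
have := class_ball cs v u; elim: D v => [|j IH] w.
  rewrite inE => /eqP->; have : x \in log (st 0 u) by rewrite addn0 log_start.
  by elim: t {q} => // t IHt /IHt; apply: log_mono.
case/in_neighbourhood => y /IH xy; case/orP => [/eqP<-//|/andP[yw /eqP ywc]].
apply: (sent_received yw _ (Logic.eq_sym ywc)).
by move/activePn: (q y); apply.
Qed.

Lemma ended_bound v : ended (run (t0 + (D + 2 * a + 2 + span rho)) v).
Proof. by apply/endedP; exists (D + 2 * a + 2) => //; exact: idle_bound. Qed.

Lemma broadcast_done_after T : t0 + (D + 2 * a + 2 + span rho) < T ->
  broadcast_done T omega.
Proof.
move=> lt; case: (config_run T) => [[_ no]|[t _ IH]].
  by have := no _ l lt; rewrite ended_bound.
apply/forallP => v; have [en ->] := IH v.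
have /endedP[s E q] := en.
(* Termination occurs [span rho] rounds after the idle round s, and idleness persists. *)
have q' : idle (s + span rho).
  by elim: (span rho) => [|j IHj]; rewrite ?addn0 // addnS; exact: idle_step.
have logE := idle_complete v q'; rewrite -E in logE.
move: en; rewrite /ended /= /result; case: ifP => // _ _.
apply/andP; split; apply/allP => z /=.
  case/mapP => x; rewrite logE => /all_items_messages[u xu _] ->.
  by apply/flattenP; exists (msgs u) => //; apply/mapP; exists u; rewrite ?mem_enum.
case/flattenP => m /mapP[u _ ->] /messages_all_items[x xa <-].
by apply: map_f; rewrite logE.
Qed.

End Classes.
End Run.

Local Open Scope ring_scope.

(** * Independent random blocks *)

Section ProductSpace.
Variable R : realFieldType.

Lemma sum_dffun_prod (I : finType) (T : I -> finType) (F : forall i, T i -> R) :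
  \sum_(f : {dffun forall i : I, T i}) \prod_i F i (f i)
  = \prod_i \sum_(x : T i) F i x.
Proof.
(* Distributivity is applied to functions into the tagged union of the T i, and [dffun_of_fprod]
   translates them back. *)
transitivity (\prod_i \sum_(j in tagged_with T i)
                untag 0 (fun x => [ffun y => F i y] x) j); last first.
  apply: eq_bigr => i _; rewrite -(big_tag (fun i x => [ffun y => F i y] x)).
  by apply: eq_bigr => x _; rewrite ffunE.
rewrite bigA_distr_big_dep -big_fprod.
rewrite (reindex (@dffun_of_fprod I T)) /=; last first.
  exact/onW_bij/dffun_of_fprod_bij.
by apply: eq_bigr => f _; apply: eq_bigr => i _; rewrite !ffunE.
Qed.

Lemma sum_tuple_cat (T : finType) (a c : nat) (F : seq T -> R) :
  \sum_(s : (a + c).-tuple T) F s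
  = \sum_(x : a.-tuple T) \sum_(y : c.-tuple T) F (x ++ y).
Proof.
rewrite pair_big /=.
pose h (q : a.-tuple T * c.-tuple T) := cat_tuple q.1 q.2.
have tk (s : (a + c).-tuple T) : size (take a s) == a.
  by rewrite size_takel // size_tuple leq_addr.
have dr (s : (a + c).-tuple T) : size (drop a s) == c.
  by rewrite size_drop size_tuple addKn.
rewrite (reindex h) //=; apply: onW_bij.
exists (fun s => (Tuple (tk s), Tuple (dr s))) => [[x y]|s].
  by congr pair; apply: val_inj;
    rewrite /= ?take_size_cat ?drop_size_cat // size_tuple.
by apply: val_inj; rewrite /= cat_take_drop.
Qed.

(** The blocks of a uniform string are independent: split off the first one and induct. *)
Lemma sum_tuple_blocks (T : finType) (m b : nat) (g : nat -> seq T -> R) :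
  \sum_(s : (m * b).-tuple T) \prod_(p < m) g p (take b (drop (p * b) s))
  = \prod_(p < m) \sum_(x : b.-tuple T) g p x.
Proof.
elim: m g => [|m IH] g.
  under eq_bigr => s _ do rewrite big_ord0.
  by rewrite big_ord0 sumr_const card_tuple.
have := @sum_tuple_cat T b (m * b)
  (fun s => \prod_(p < m.+1) g p (take b (drop (p * b) s))).
rewrite -mulSn => ->; rewrite big_ord_recl.
rewrite (_ : \prod_(i < m) _ = \prod_(p < m) \sum_(x : b.-tuple T) g p.+1 x) //.
rewrite -(IH (fun p => g p.+1)) big_distrl /=.
apply: eq_bigr => x _; rewrite big_distrr; apply: eq_bigr => y _ /=.
rewrite big_ord_recl /= mul0n drop0 take_size_cat ?size_tuple //.
congr (_ * _); apply: eq_bigr => p _.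
rewrite /bump /= add1n mulSn addnC -drop_drop.
by rewrite drop_size_cat ?size_tuple.
Qed.

Definition bits_mean (l : nat) (F : seq bool -> R) : R :=
  (2 ^+ l)^-1 * \sum_(y : l.-tuple bool) F y.

(** A prefix of a uniform string is uniform, as every value has 2^(b - l) extensions. *)
Lemma sum_tuple_prefix (l b : nat) (F : seq bool -> R) : (l <= b)%N ->
  \sum_(x : b.-tuple bool) F (take l x) = 2 ^+ b * bits_mean l F.
Proof.
move=> lb; have [c ->] : exists c, b = (l + c)%N by exists (b - l)%N; lia.
rewrite (@sum_tuple_cat bool l c (fun s => F (take l s))) /bits_mean.
under eq_bigr => x _ do under eq_bigr => y _ do
  rewrite take_size_cat ?size_tuple //.
under eq_bigr => x _ do rewrite sumr_const card_tuple card_bool.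
rewrite sumrMnl -[LHS]mulr_natl natrX exprD mulrA [2 ^+ l * _]mulrC mulfK //.
by rewrite expf_neq0 ?pnatr_eq0.
Qed.

Lemma bits_mean_eq (l : nat) (c : seq bool) (u w : R) : size c = l ->
  bits_mean l (fun y => if y == c then u else w)
  = (2 ^+ l)^-1 * u + (1 - (2 ^+ l)^-1) * w.
Proof.
move=> cl; rewrite /bits_mean.
have cP : size c == l by apply/eqP.
rewrite (bigD1 (Tuple cP)) //= eqxx.
have -> : \sum_(y : l.-tuple bool | y != Tuple cP) (if tval y == c then u else w)
    = \sum_(y : l.-tuple bool | y != Tuple cP) w.
  by apply: eq_bigr => y /negPf; rewrite -val_eqE /= => ->.
rewrite sumr_const; have := cardC1 (Tuple cP); rewrite card_tuple card_bool.
have -> : #|predC1 (Tuple cP)| = #|[pred y | y != Tuple cP]| by [].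
move=> ->; rewrite -[w *+ _]mulr_natl -subn1 natrB ?expn_gt0 // natrX.
have : (2 ^+ l : R) != 0 by rewrite expf_neq0 ?pnatr_eq0.
by move: (2 ^+ l) => x x0; field.
Qed.

Lemma bits_mean_const (l : nat) (u : R) : bits_mean l (fun=> u) = u.
Proof.
rewrite /bits_mean sumr_const card_tuple card_bool -[u *+ _]mulr_natl natrX mulKf //.
by rewrite expf_neq0 ?pnatr_eq0.
Qed.

Variables (V : finType) (N : V -> nat) (b l : nat).
Hypothesis lb : (l <= b)%N.
Local Notation space := {dffun forall v : V, (N v * b).-tuple bool}.

Definition mean (f : space -> R) : R :=
  (\sum_(omega : space) f omega) / #|{: space}|%:R.

Lemma card_space_gt0 : 0 < #|{: space}|%:R :> R.
Proof.
rewrite ltr0n; apply/card_gt0P.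
by exists [ffun v => nseq_tuple (N v * b) false].
Qed.

(** Independence of all prefixes, over all nodes and blocks; the laws of the random edge sets and of
    the loads both follow from it. *)
Lemma mean_blocks (G : V -> nat -> seq bool -> R) :
  mean (fun omega => \prod_v \prod_(p < N v) G v p (take l (block b p (omega v))))
  = \prod_v \prod_(p < N v) bits_mean l (G v p).
Proof.
rewrite /mean (sum_dffun_prod
  (fun v (s : (N v * b).-tuple bool) =>
     \prod_(p < N v) G v p (take l (block b p s)))).
have cardE : #|{: space}|%:R = \prod_v \prod_(p < N v) (2 ^+ b : R).
  rewrite -sum1_card natr_sum.
  transitivity (\prod_v \sum_(s : (N v * b).-tuple bool) (1 : R)).
    rewrite -(sum_dffun_prod (fun v (_ : (N v * b).-tuple bool) => 1 : R)).
    by apply: eq_bigr => f _; rewrite big1.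
  apply: eq_bigr => v _; rewrite sumr_const card_tuple card_bool.
  by rewrite prodr_const card_ord natrX -exprM mulnC.
have -> : \prod_v \sum_(s : (N v * b).-tuple bool)
     \prod_(p < N v) G v p (take l (block b p s))
   = (\prod_v \prod_(p < N v) bits_mean l (G v p)) * #|{: space}|%:R.
  rewrite cardE -big_split; apply: eq_bigr => v _ /=; rewrite -big_split /=.
  rewrite (sum_tuple_blocks (T := bool) (N v) b (fun p s => G v p (take l s))).
  by apply: eq_bigr => p _; rewrite sum_tuple_prefix // mulrC.
by rewrite mulfK // gt_eqF // card_space_gt0.
Qed.

Lemma mean_le f g : (forall omega, f omega <= g omega) -> mean f <= mean g.
Proof.
by move=> fg; rewrite /mean ler_wpM2r ?invr_ge0 ?ler0n // ler_sum.
Qed.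

Lemma mean_sum (I : finType) (P : pred I) (f : I -> space -> R) :
  mean (fun omega => \sum_(i | P i) f i omega) = \sum_(i | P i) mean (f i).
Proof. by rewrite /mean exchange_big /= big_distrl. Qed.

Lemma meanZ (x : R) f : mean (fun omega => x * f omega) = x * mean f.
Proof. by rewrite /mean -big_distrr mulrA. Qed.

Lemma mean_pred (P : pred space) :
  mean (fun omega => (P omega)%:R) = #|P|%:R / #|{: space}|%:R.
Proof.
rewrite /mean -[#|P|]sum1_card natr_sum [in RHS]big_mkcond; congr (_ / _).
by apply: eq_bigr => w _; rewrite unfold_in; case: (P w).
Qed.

End ProductSpace.

(** * Random subgraphs *)

Section PolyGrowth.
Import classical_sets functions topology normedtype derive realfun.
Import numFieldNormedType.Exports.
Local Open Scope classical_set_scope.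

(** The hypothesis says that g(x) / x^n has a nonnegative derivative, so by the mean value theorem
    its value at q is at most its value at 1. *)
Lemma poly_growth (R : realType) (g : {poly R}) (n : nat) (q : R) :
  0 < q -> q <= 1 ->
  (forall x : R, 0 < x -> x < 1 -> n%:R * g.[x] <= x * g^`().[x]) ->
  g.[q] <= g.[1] * q ^+ n.
Proof.
move=> q0; rewrite le_eqVlt => /predU1P[->|q1] growth.
  by rewrite expr1n mulr1.
pose f (x : R) := g.[x] * (x ^+ n)^-1.
pose df (x : R) := g.[x] *: (- (x ^+ n) ^- 2 *: (('X^n : {poly R})^`()).[x])
  + (x ^+ n)^-1 *: g^`().[x].
have dfP (x : R) : 0 < x -> is_derive x 1 f (df x).
  move=> x0; have xn0 : ('X^n : {poly R}).[x] != 0.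
    by rewrite hornerXn expf_neq0 ?gt_eqF.
  have := is_deriveM (is_derive_poly g x)
    (is_deriveV (f := horner ('X^n : {poly R})) xn0 (is_derive_poly 'X^n x)).
  rewrite hornerXn -/(df x); congr (is_derive _ _ _ _).
  by apply: boolp.funext => y; rewrite /= !fctE hornerXn.
have [||c] := @MVT R f df q 1 q1.
- by move=> x; rewrite in_itv /= => /andP[qx _]; apply: dfP; apply: lt_trans qx.
- apply: (derivable_within_continuous (i := `[q, 1]%R)) => x.
  rewrite in_itv /= => /andP[qx _].
  by have [] := dfP x (lt_le_trans q0 qx).
rewrite in_itv /= => /andP[qc c1] E.
have c0 : 0 < c := lt_trans q0 qc.
have C0 : 0 < c ^+ n by rewrite exprn_gt0.
have df0 : 0 <= df c.
  rewrite -(pmulr_rge0 _ (mulr_gt0 c0 C0)) /df derivXn hornerMn hornerXn.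
  have wc : c ^+ n.-1 *+ n * c = n%:R * c ^+ n.
    by case: (n) => [|j]; rewrite ?mulr0n ?mul0r // -mulr_natl -mulrA -exprSr.
  have -> : c * c ^+ n * (g.[c] *: (- c ^+ n ^- 2 *: (c ^+ n.-1 *+ n)) + c ^- n *: g^`().[c])
     = c * g^`().[c] - n%:R * g.[c].
    rewrite /GRing.scale /=; move: (c ^+ n.-1 *+ n) wc => w wc.
    have -> : w = n%:R * c ^+ n / c by rewrite -wc mulfK ?gt_eqF.
    by field; rewrite ?gt_eqF.
  by rewrite subr_ge0 growth.
have : f q <= f 1 by rewrite -subr_ge0 E mulr_ge0 // subr_ge0 ltW.
by rewrite /f expr1n invr1 mulr1 ler_pdivrMr // exprn_gt0.
Qed.

End PolyGrowth.

(** * Components and crossing edges *)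

Section Components.
Variables (V : finType) (E : {set V * V}).
Implicit Types (A B : {set V * V}) (u v x y : V).

Definition symgraph B : rel V := fun v w => ((v, w) \in B) || ((w, v) \in B).

Lemma symgraph_sym B : symmetric (symgraph B).
Proof. by move=> v w; rewrite /symgraph orbC. Qed.

Definition component B x : {set V} := [set y | connect (symgraph B) x y].

Definition components B : {set {set V}} := [set component B x | x in V].

Lemma component_eq B x y : y \in component B x -> component B y = component B x.
Proof.
have sym := sym_connect_sym (symgraph_sym B).
rewrite inE => xy; apply/setP => z; rewrite !inE.
by rewrite (same_connect sym xy).
Qed.

(** Additional edges can only merge components, so the coarser partition is an image of the finer
    one; counting images then compares the numbers of components. *)
Lemma components_image B B' : B \subset B' -> exists f : {set V} -> {set V},
  (forall x, f (component B x) = component B' x)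
  /\ components B' = f @: components B.
Proof.
move=> sub; exists (fun Q : {set V} => \bigcup_(x in Q) component B' x).
have fE x : \bigcup_(y in component B x) component B' y = component B' x.
  apply/setP => z; apply/bigcupP/idP => [[y]|zx]; last first.
    by exists x => //; rewrite inE connect0.
  rewrite !inE => xy; apply: connect_trans; move: y xy.
  apply: connect_sub => y w yw; apply: connect1.
  by case/orP: yw => /(subsetP sub) yw; rewrite /symgraph yw ?orbT.
split=> //; rewrite /components -imset_comp; apply: eq_imset => x /=.
by rewrite fE.
Qed.

Lemma components_mono B B' : B \subset B' -> (#|components B'| <= #|components B|)%N.
Proof. by case/components_image => f [_ ->]; apply: leq_imset_card. Qed.

Lemma components_merge B a : a.2 \notin component B a.1 ->
  (#|components (a |: B)| < #|components B|)%N.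
Proof.
move=> na; have [f [fE ->]] := components_image (subsetUr [set a] B).
have in1 : component B a.1 \in components B by apply: imset_f.
have merge : f (component B a.1) = f (component B a.2).
  rewrite !fE; apply/esym/component_eq; rewrite inE; apply: connect1.
  by rewrite /symgraph !inE -surjective_pairing eqxx.
have -> : f @: components B = f @: (components B :\ component B a.1).
  apply/eqP; rewrite eqEsubset andbC imsetS ?subD1set //=.
  apply/subsetP => Q /imsetP[S SB ->].
  have [->|ne] := eqVneq S (component B a.1); last first.
    by apply: imset_f; rewrite !inE ne.
  rewrite merge; apply: imset_f; rewrite !inE imset_f // andbT.
  by apply/eqP => E2; move: na; rewrite -E2 inE connect0.
apply: leq_ltn_trans (leq_imset_card _ _) _.
by rewrite [X in (_ < X)%N](cardsD1 (component B a.1)) in1.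
Qed.

Definition crossing B : {set V * V} := [set a in E | a.2 \notin component B a.1].

(** Each component is a proper nonempty set and is left by at least lam edges, while a crossing edge
    leaves only the components of its two ends. *)
Lemma card_crossing lam B : (1 < #|components B|)%N ->
  (forall S : {set V}, S != set0 -> S != setT -> lam <= cut_size (symgraph E) S)%N ->
  (lam * #|components B| <= 2 * #|crossing B|)%N.
Proof.
move=> c1 cuts.
have le1 : (lam * #|components B| <=
    \sum_(Q in components B) cut_size (symgraph E) Q)%N.
  rewrite mulnC -sum_nat_const; apply: leq_sum => Q QB; apply: cuts.
    by case/imsetP: QB => x _ ->; apply/set0Pn; exists x; rewrite inE connect0.
  apply/eqP => QT; move: c1; rewrite ltnNge => /negP; apply.
  rewrite (_ : components B = [set setT]) ?cards1 //; apply/setP => S.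
  rewrite inE; apply/idP/eqP => [/imsetP[y _ ->]|->]; last by rewrite -QT.
  case/imsetP: QB QT => x _ -> xT.
  by have /component_eq -> : y \in component B x by rewrite xT.
apply: leq_trans le1 _.
pose P := [set p : V * V | symgraph E p.1 p.2 && (p.2 \notin component B p.1)].
(* An ordered pair p is counted for at most one Q, the component of its first vertex. *)
have le2 : (\sum_(Q in components B) cut_size (symgraph E) Q <= #|P|)%N.
  rewrite /cut_size; under eq_bigr => Q _ do rewrite -sum1_card big_mkcond /=.
  rewrite exchange_big -sum1_card [X in (_ <= X)%N]big_mkcond /=.
  apply: leq_sum => p _; rewrite inE.
  have one Q : Q \in components B -> p.1 \in Q -> Q = component B p.1.
    by case/imsetP => x _ -> /component_eq.
  case: ifP => [_|/negP no]; last first.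
    rewrite big1 // => Q QB; case: ifP => //; rewrite unfold_in => /and3P[p1 p2 pe].
    by case: no; rewrite pe -(one Q).
  rewrite (bigD1 (component B p.1)) ?imset_f //= big1 ?addn0 => [|Q /andP[QB ne]].
    by case: ifP.
  case: ifP => //; rewrite unfold_in => /and3P[p1 _ _].
  by move: ne; rewrite (one Q) // eqxx.
apply: leq_trans le2 _.
pose swap (a : V * V) := (a.2, a.1).
have sub : P \subset crossing B :|: swap @: crossing B.
  apply/subsetP => -[v w]; rewrite !inE /= => /andP[/orP[vw|wv] nc].
    by rewrite vw nc.
  apply/orP; right; apply/imsetP; exists (w, v) => //; rewrite !inE wv /=.
  by rewrite (sym_connect_sym (symgraph_sym B)) in nc.
apply: leq_trans (subset_leq_card sub) _; apply: leq_trans (leq_card_setU _ _) _.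
by rewrite mul2n -addnn leq_add2l leq_imset_card.
Qed.

Lemma connected_components B : (#|components B| <= 1)%N ->
  connected_graph (symgraph B).
Proof.
move=> c1 x y; have : component B x = component B y.
  by apply: (card_le1_eqP c1); apply: imset_f.
by move/setP/(_ y); rewrite !inE connect0.
Qed.

Lemma components_gt0 B (x : V) : (0 < #|components B|)%N.
Proof. by apply/card_gt0P; exists (component B x); apply: imset_f. Qed.

End Components.

(** * Random subsets and Russo's formula *)

Section RandomSubset.
Variables (R : realType) (T : finType) (E : {set T}).
Implicit Types (B F : {set T}) (q : R).

(* Every element of E is present with probability 1 - q. *)
Definition weight q B : R := q ^+ #|E :\: B| * (1 - q) ^+ #|B|.

Lemma weight_ge0 q B : 0 <= q -> q <= 1 -> 0 <= weight q B.
Proof. by move=> q0 q1; rewrite mulr_ge0 ?exprn_ge0 ?subr_ge0. Qed.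

(** Expand a product with one factor per element, a sum of a term for presence and one for absence.
    Zero presence terms discard the sets that leave E or meet F; the factors are q on F and 1
    elsewhere. *)
Lemma weight_avoid q F : F \subset E ->
  \sum_(B : {set T} | (B \subset E) && [disjoint B & F]) weight q B = q ^+ #|F|.
Proof.
move=> FE.
have := @bigA_distr R 0 1 *%R +%R T
  (fun a => if a \in E :\: F then 1 - q else 0) (fun a => if a \in E then q else 1).
have -> : \prod_a ((if a \in E :\: F then 1 - q else 0) + (if a \in E then q else 1))
    = q ^+ #|F|.
  rewrite -prodr_const [RHS]big_mkcond /=; apply: eq_bigr => a _; rewrite !inE.
  have [/(subsetP FE)->|_] := boolP (a \in F); first by rewrite add0r.
  by case: (a \in E) => /=; rewrite ?subrK ?add0r.
move=> ->; rewrite big_mkcond /=; apply: eq_bigr => B _.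
case: ifP => [/andP[BE BF]|/negP no].
  rewrite (bigID (mem B)) /= /weight mulrC -!prodr_const; congr (_ * _).
    apply: eq_bigr => a aB; rewrite aB !inE (subsetP BE) // andbT.
    by rewrite (disjointFr BF).
  rewrite [in LHS]big_mkcond [in RHS]big_mkcond /=; apply: eq_bigr => a _.
  by rewrite !inE; case: (a \in B); case: (a \in E).
have [a aB aEF] : exists2 a, a \in B & a \notin E :\: F.
  apply/subsetPn; apply/negP; rewrite subsetD => H; exact: no.
by rewrite (bigD1 a) //= aB (negPf aEF) mul0r.
Qed.

(** The expectation of X as a polynomial in the absence probability, which allows formal
    differentiation. *)
Definition expectation_poly (X : {set T} -> R) : {poly R} :=
  \sum_(B : {set T} | B \subset E)
     X B *: ('X ^+ #|E :\: B| * (1 - 'X) ^+ #|B|).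

Lemma expectation_polyE X q :
  (expectation_poly X).[q] = \sum_(B : {set T} | B \subset E) weight q B * X B.
Proof.
rewrite horner_sum; apply: eq_bigr => B _.
by rewrite !hornerE /weight [RHS]mulrC mulrA.
Qed.

(** Differentiating q^i (1 - q)^j, with i absent and j present elements, gives i times the weight of
    B minus the weights of the j sets obtained by deleting one element of B. Regrouping by the
    smaller set leaves the differences of X. *)
Lemma Russo_formula X q :
  q * (expectation_poly X)^`().[q]
  = \sum_(B : {set T} | B \subset E)
      weight q B * \sum_(a in E :\: B) (X B - X (a |: B)).
Proof.
have termE (i j : nat) : q * ('X ^+ i * (1 - 'X) ^+ j : {poly R})^`().[q]
    = q ^+ i * (1 - q) ^+ j *+ i - q ^+ i.+1 * (1 - q) ^+ j.-1 *+ j.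
  have d1 : q * (('X ^+ i : {poly R})^`()).[q] = q ^+ i *+ i.
    rewrite derivXn hornerMn hornerXn mulrnAr; case: i => [|i]; first by rewrite !mulr0n.
    by rewrite -exprS.
  have e1 k : ((1 - 'X) ^+ k : {poly R}).[q] = (1 - q) ^+ k.
    by rewrite horner_exp hornerD hornerN hornerX hornerC.
  have d2 : (((1 - 'X) ^+ j : {poly R})^`()).[q] = - ((1 - q) ^+ j.-1 *+ j).
    rewrite deriv_exp derivB derivC derivX sub0r hornerMn hornerM e1.
    by rewrite hornerN hornerC mulN1r mulNrn.
  rewrite derivM hornerD !hornerM mulrDr mulrA d1 hornerXn e1 d2.
  by rewrite mulrnAl !mulrN mulrA -exprS mulrnAr.
rewrite /expectation_poly raddf_sum horner_sum big_distrr /=.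
transitivity (\sum_(B : {set T} | B \subset E)
   (\sum_(a in E :\: B) weight q B * X B
    - \sum_(a in B) weight q (B :\ a) * X B)).
  apply: eq_bigr => B BE.
  rewrite derivZ hornerZ mulrCA termE mulrBr; congr (_ - _).
    by rewrite sumr_const mulrnAr mulrC.
  rewrite (eq_bigr (fun=> q ^+ #|E :\: B|.+1 * (1 - q) ^+ #|B|.-1 * X B)).
    by rewrite sumr_const mulrnAr mulrC.
  move=> a aB; rewrite /weight; congr (q ^+ _ * (1 - q) ^+ _ * _).
    have -> : E :\: (B :\ a) = a |: (E :\: B).
      apply/setP => x; rewrite !inE; have [->|] := eqVneq x a => //=.
      by rewrite (subsetP BE).
    by rewrite cardsU1 !inE aB.
  by rewrite [in RHS](cardsD1 a) aB.
rewrite sumrB.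
(* For fixed a, the sets that contain a correspond to those that do not. *)
have -> : \sum_(B : {set T} | B \subset E) \sum_(a in B) weight q (B :\ a) * X B
  = \sum_(B : {set T} | B \subset E) \sum_(a in E :\: B) weight q B * X (a |: B).
  rewrite (exchange_big_dep (mem E)) /=; last by move=> B a BE /(subsetP BE).
  rewrite [RHS](exchange_big_dep (mem E)) /=; last by move=> B a _; rewrite inE => /andP[].
  apply: eq_bigr => a aE.
  rewrite (reindex_onto (fun B => a |: B) (fun B => B :\ a)) /=; last first.
    by move=> B /andP[_ aB]; rewrite setD1K.
  apply: eq_big => [B|B /andP[_ /eqP E1]]; last by rewrite E1.
  rewrite !inE eqxx aE !andbT subUset sub1set aE /=.
  have -> : ((a |: B) :\ a == B) = (a \notin B).
    apply/eqP/idP => [<-|/setU1K->//]; by rewrite !inE eqxx.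
  by [].
rewrite -sumrB; apply: eq_bigr => B _; rewrite -sumrB big_distrr /=.
by apply: eq_bigr => a _; rewrite mulrBr.
Qed.

End RandomSubset.

Section ExpBounds.
Variable R : realType.

Lemma exp1Dx_le (x : R) n : 0 <= x -> (1 + x) ^+ n <= expR (n%:R * x).
Proof.
move=> x0; rewrite expRM_natl lerXn2r ?nnegrE ?expR_ge1Dx ?expR_ge0 //.
by rewrite addr_ge0.
Qed.

Lemma expR_le_inv (x : R) : x < 1 -> expR x <= (1 - x)^-1.
Proof.
move=> x1; rewrite -[x in expR x]opprK expRN lef_pV2 ?posrE ?expR_gt0 ?subr_gt0 //.
exact: expR_ge1Dx.
Qed.

Lemma expR1_le4 : expR 1 <= 4 :> R.
Proof.
have h : expR (2^-1 : R) <= 2.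
  apply: le_trans (expR_le_inv _) _; first by lra.
  by rewrite (_ : 1 - 2^-1 = 2^-1 :> R) ?invrK //; lra.
have -> : (1 : R) = 2%:R * 2^-1 by rewrite mulfV ?pnatr_eq0.
rewrite expRM_natl; have : 0 <= expR (2^-1 : R) := expR_ge0 _.
move: (expR _) h => y y2 y0; rewrite expr2; nra.
Qed.

Lemma expRm1_le : expR (- 1) <= 2^-1 :> R.
Proof.
rewrite expRN lef_pV2 ?posrE ?expR_gt0 //.
by have := expR_ge1Dx (1 : R); lra.
Qed.

End ExpBounds.

(** * Connectivity and expansion of a random subgraph *)

Section RandomSubgraph.
Variables (R : realType) (V : finType) (E : {set V * V}) (x0 : V) (q : R).
Hypotheses (q0 : 0 <= q) (q1 : q <= 1).
Local Notation n := #|V|.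

(** By Markov's inequality the expectation of X, the number of components minus one, bounds this
    probability; [poly_growth] compares it with its value at absence probability 1. *)
Lemma disconnected_weight lam : 0 < q ->
  (forall S : {set V}, S != set0 -> S != setT -> lam <= cut_size (symgraph E) S)%N ->
  \sum_(B : {set V * V} | (B \subset E) && (1 < #|components B|)%N) weight E q B
    <= n%:R * q ^+ lam./2.
Proof.
move=> qpos cuts; pose X (B : {set V * V}) : R := #|components B|%:R - 1.
have X0 B : 0 <= X B by rewrite subr_ge0 ler1n (components_gt0 _ x0).
have := @poly_growth R (expectation_poly E X) lam./2 q qpos q1.
rewrite !expectation_polyE => growth.
apply: (@le_trans _ _ (\sum_(B : {set V * V} | B \subset E) weight E q B * X B)).
  rewrite big_mkcondr; apply: ler_sum => B BE; case: ifP => [c1|_].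
    rewrite ler_peMr ?weight_ge0 // lerBrDr.
    by move: c1; rewrite -(ler_nat R).
  by rewrite mulr_ge0 ?weight_ge0.
apply: le_trans (growth _) _ => [x xpos x1|]; last first.
  apply: ler_wpM2r; first by rewrite exprn_ge0.
  (* At absence probability 1 only the empty graph has weight, and it has at most n components. *)
  rewrite (bigD1 set0) ?sub0set //= big1 ?addr0 => [|B /andP[_ B0]]; last first.
    by rewrite /weight subrr expr0n cards_eq0 (negPf B0) mulr0 mul0r.
  rewrite /weight cards0 expr0 expr1n !mul1r lerBlDr.
  by rewrite natr1 ler_nat; apply: leqW; apply: leq_imset_card.
rewrite expectation_polyE Russo_formula big_distrr; apply: ler_sum => B BE.
rewrite /= mulrCA ler_wpM2l ?weight_ge0 ?(ltW xpos) ?(ltW x1) //.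
have term a : 0 <= X B - X (a |: B).
  by rewrite /X opprB addrA subrK subr_ge0 ler_nat components_mono ?subsetUr.
have [c1|c1] := leqP #|components B| 1.
  have XB : X B = 0.
    rewrite /X (_ : #|components B| = 1%N) ?subrr //.
    by apply/eqP; rewrite eqn_leq c1 (components_gt0 _ x0).
  rewrite [leLHS](_ : _ = 0); last by rewrite XB mulr0.
  by apply: sumr_ge0 => a _; exact: term.
have cr := card_crossing c1 cuts.
have crE : crossing E B \subset E :\: B.
  apply/subsetP => -[v w]; rewrite !inE /= => /andP[-> nc]; rewrite andbT.
  apply: contra nc => vwB; apply: connect1; by rewrite /symgraph vwB.
(* Every crossing edge lowers X by at least one, and there are at least lam c / 2 of them, c being
   the number of components. *)
apply: (@le_trans _ _ (#|crossing E B|%:R)).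
  rewrite /X -{1}(prednK (components_gt0 B x0)) -natr1 addrK -natrM ler_nat.
  have := odd_double_half lam; move: lam./2 (odd lam) => hl b E1.
  by move: cr; rewrite -E1; move: c1; lia || nia.
rewrite (big_setID (crossing E B)) /= (setIidPr crE) -sum1_card natr_sum.
rewrite -[leLHS]addr0 lerD ?sumr_ge0 //.
apply: ler_sum => a; rewrite inE => /andP[_ nc].
rewrite /X opprB addrA subrK lerBrDr -natrD add1n ler_nat.
exact: components_merge.
Qed.

Definition nonexpanding (del : nat) (B : {set V * V}) : bool :=
  [exists X : {set V}, [&& X != set0, (4 * #|X| <= del)%N
    & (#|neighbourhood (symgraph B) X| < 2 * #|X|)%N]].

(** If Y is the closed neighbourhood of X in a subgraph, then all these edges are absent from it. *)
Definition leaving (X Y : {set V}) : {set V * V} :=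
  [set a in E | (a.1 \in X) && (a.2 \notin Y) || (a.2 \in X) && (a.1 \notin Y)].

Lemma card_leaving del (X Y : {set V}) :
  (forall v, del <= #|[set w | symgraph E v w]|)%N -> X \subset Y ->
  (#|X| * (del - #|Y|) <= #|leaving X Y|)%N.
Proof.
move=> deg XY.
pose P := [set p : V * V | [&& p.1 \in X, p.2 \notin Y & symgraph E p.1 p.2]].
have le1 : (#|X| * (del - #|Y|) <= #|P|)%N.
  have -> : #|P| = (\sum_(x in X) #|[set w | symgraph E x w] :\: Y|)%N.
    rewrite -sum1_card (eq_bigl (fun p : V * V => (p.1 \in X) &&
      (p.2 \in [set w | symgraph E p.1 w] :\: Y))); last by move=> p; rewrite !inE.
    rewrite -(pair_big_dep (mem X)
      (fun x w => w \in [set w | symgraph E x w] :\: Y) (fun _ _ => 1%N)) /=.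
    by apply: eq_bigr => x _; rewrite sum1_card.
  rewrite -sum_nat_const; apply: leq_sum => x _; rewrite cardsD.
  apply: leq_sub (deg x) _; exact: subset_leq_card (subsetIr _ _).
apply: leq_trans le1 _.
(* Each pair is oriented as in E. No two pairs are identified, since only the first vertex lies in X
   and the second is outside Y, which contains X. *)
pose f (p : V * V) := if p \in E then p else (p.2, p.1).
have finj : {in P &, injective f}.
  move=> [x w] [x' w']; rewrite !inE /f /= => /and3P[xX wY _] /and3P[x'X w'Y _].
  have ne : x <> w' by move=> E1; move: w'Y; rewrite -E1 (subsetP XY).
  by case: ifP => _; case: ifP => _; case=> E1 E2;
    [rewrite E1 E2 | case: ne | case: ne | rewrite E1 E2].
rewrite -(card_in_imset finj); apply: subset_leq_card.
apply/subsetP => _ /imsetP[[x w] + ->]; rewrite !inE /f /= => /and3P[xX wY].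
by case: ifP => [-> _|no]; rewrite /symgraph ?no /= ?xX ?wY ?orbT // => ->.
Qed.

Lemma sum_powers_card (T : finType) (x : R) :
  \sum_(X : {set T}) x ^+ #|X| = (1 + x) ^+ #|T|.
Proof.
have := @bigA_distr R 0 1 *%R +%R T (fun=> x) (fun=> 1).
rewrite prodr_const addrC => ->; apply: eq_big => [X|X _]; first by rewrite inE.
by rewrite -big_mkcond prodr_const.
Qed.

(* Union bound over X and its neighbourhood Y; the factor n^(2|X| - |Y|) >= 1
   turns the sum over both into a product of two binomial expansions. *)
Lemma nonexpanding_weight del h :
  (forall v, del <= #|[set w | symgraph E v w]|)%N ->
  (forall s, 4 * s <= del -> h + 2 * s <= del)%N ->
  \sum_(B : {set V * V} | (B \subset E) && nonexpanding del B) weight E q B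
    <= ((1 + n%:R ^+ 2 * q ^+ h) ^+ n - 1) * (1 + n%:R^-1) ^+ n.
Proof.
move=> deg hdel.
pose cond (p : {set V} * {set V}) :=
  [&& p.1 != set0, (4 * #|p.1| <= del)%N, p.1 \subset p.2
    & (#|p.2| < 2 * #|p.1|)%N].
have n0 : 0 < n%:R :> R by rewrite ltr0n; apply/card_gt0P; exists x0.
have n1 : 1 <= n%:R :> R by rewrite ler1n; apply/card_gt0P; exists x0.
apply: (@le_trans _ _ (\sum_(B : {set V * V} | B \subset E)
   \sum_(p | cond p) if [disjoint B & leaving p.1 p.2] then weight E q B else 0)).
  rewrite big_mkcondr; apply: ler_sum => B BE.
  have nneg p : 0 <= (if [disjoint B & leaving p.1 p.2] then weight E q B else 0).
    by case: ifP => // _; rewrite weight_ge0.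
  case: ifP => [/existsP[X /and3P[X0 X4 X2]]|_]; last by rewrite sumr_ge0.
  rewrite (bigD1 (X, neighbourhood (symgraph B) X)) /=; last first.
    by rewrite /cond /= X0 X4 X2 subsetUl.
  rewrite ifT ?lerDl ?sumr_ge0 //.
  apply/pred0P => -[v w]; apply/negP => /= /andP[vw]; rewrite inE => /andP[_] /=.
  case/orP => /andP[xX /negP]; apply; apply/in_neighbourhood.
    by exists v; rewrite // /symgraph vw orbT.
  by exists w; rewrite // /symgraph vw !orbT.
rewrite exchange_big /=.
have -> : ((1 + n%:R ^+ 2 * q ^+ h) ^+ n - 1) * (1 + n%:R^-1) ^+ n =
   \sum_(X : {set V} | X != set0) \sum_(Y : {set V})
     (n%:R ^+ 2 * q ^+ h) ^+ #|X| * n%:R^-1 ^+ #|Y|.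
  rewrite -!sum_powers_card (bigD1 set0) //= cards0 expr0 addrC addrK big_distrl.
  by apply: eq_bigr => X _; rewrite big_distrr.
rewrite [leRHS]pair_big_dep /= [leLHS]big_mkcond [leRHS]big_mkcond /=.
apply: ler_sum => -[X Y] _ /=.
have npos : 0 <= (n%:R ^+ 2 * q ^+ h) ^+ #|X| * n%:R^-1 ^+ #|Y|.
  by rewrite mulr_ge0 ?exprn_ge0 ?mulr_ge0 ?exprn_ge0 ?invr_ge0.
rewrite andbT; case: ifP => [/and4P[/= -> X4 XY Y2]|_]; last by case: ifP.
rewrite -big_mkcondr weight_avoid; last by apply/subsetP => a; rewrite inE => /andP[].
(* As |Y| < 2 |X|, each vertex of X has at least del - |Y| >= h edges that leave Y. *)
apply: (@le_trans _ _ ((q ^+ h) ^+ #|X|)).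
  rewrite -exprM ler_wiXn2l //; apply: leq_trans (card_leaving deg XY).
  rewrite mulnC leq_mul2l; apply/orP; right.
  by have := hdel _ X4; lia.
rewrite exprMn mulrAC ler_peMl ?exprn_ge0 // -exprM exprVn.
by rewrite ler_pdivlMr ?exprn_gt0 // mul1r ler_weXn2l // ltnW.
Qed.

(** With y = N^3 z, the first power is at most e^y <= 1 / (1 - y) <= 1 + 2 y and the second at most
    e <= 4; hence the factor 8. *)
Lemma nonexpanding_bound (N : nat) (z : R) : (0 < N)%N -> 0 <= z ->
  N%:R ^+ 3 * z <= 2^-1 ->
  ((1 + N%:R ^+ 2 * z) ^+ N - 1) * (1 + N%:R^-1) ^+ N <= 8 * (N%:R ^+ 3 * z).
Proof.
move=> N0 z0; set y := N%:R ^+ 3 * z => y2.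
have y0 : 0 <= y by rewrite mulr_ge0 ?exprn_ge0.
have a1 : (1 + N%:R ^+ 2 * z) ^+ N <= 1 + 2 * y.
  apply: le_trans (exp1Dx_le _ _) _; first by rewrite mulr_ge0 ?exprn_ge0.
  rewrite mulrA -exprS -/y; apply: le_trans (expR_le_inv _) _; first by lra.
  rewrite -div1r ler_pdivrMr; last by lra.
  nra.
have a2 : (1 + N%:R^-1 : R) ^+ N <= 4.
  apply: le_trans (exp1Dx_le _ _) _; first by rewrite invr_ge0.
  by rewrite mulfV ?pnatr_eq0 -?lt0n // expR1_le4.
have a3 : 0 <= (1 + N%:R^-1 : R) ^+ N by rewrite exprn_ge0 // addr_ge0 ?invr_ge0.
have a4 : 1 <= (1 + N%:R ^+ 2 * z) ^+ N.
  by rewrite exprn_ege1 // lerDl mulr_ge0 ?exprn_ge0.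
nra.
Qed.

End RandomSubgraph.

(** * Random classes *)

Lemma prodr_bool (R : realFieldType) (T : finType) (A : pred T) (P : T -> bool) :
  \prod_(a | A a) ((P a)%:R : R) = [forall (a | A a), P a]%:R.
Proof.
case: (boolP [forall (a | A a), P a]) => [/forall_inP all|].
  by rewrite big1 // => a /all->.
rewrite negb_forall_in => /exists_inP[a Aa /negPf Pa].
by rewrite (bigD1 a) //= Pa mul0r.
Qed.

Section Randomness.
Variables (R : realType) (K : nat) (V : finType) (e : rel V).
Variables (port : V -> seq V) (id : V -> nat) (msgs : V -> seq bits).
Variables (lam del : nat).
Hypotheses (esym : symmetric e) (eirr : irreflexive e).
Hypothesis eport : port_numbering e port.
Hypothesis id_inj : injective id.
Local Notation alg := (broadcast K).
Local Notation space := (outcome alg port id msgs lam del).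
Let b := trunc_log 2 lam.
Let N v := (size (port v) + size (msgs v))%N.
Variable M : nat.
Let l := prefix_length K lam M.
Hypothesis lb : (l <= b)%N.
Implicit Types (omega : space) (c : seq bool) (B : {set V * V}).

Local Notation mean := (@mean R V N b).
Local Notation prefix omega v p := (take l (block b p (omega v))).

(** Ports enumerate neighbours, so pairs of a node and a port are ordered adjacent pairs. The later
    blocks belong to messages and contribute 1. *)
Lemma prod_arcs (H : V -> V -> nat -> R) :
  \prod_v \prod_(p < N v)
    (if (p < size (port v))%N then H v (nth v (port v) p) p else 1)
  = \prod_(a : V * V | e a.1 a.2) H a.1 a.2 (index a.2 (port a.1)).
Proof.
rewrite -(pair_big_dep predT (fun v w => e v w)
  (fun v w => H v w (index w (port v)))) /=.
apply: eq_bigr => v _; have [upv mpv] := eport v.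
rewrite big_split_ord /= [X in _ * X]big1 ?mulr1 => [|j _]; last first.
  by rewrite ltnNge leq_addr.
rewrite (eq_bigr (fun p : 'I_(size (port v)) =>
  (fun q => H v (nth v (port v) q) (index (nth v (port v) q) (port v))) p)).
  rewrite -(big_mkord xpredT
    (fun q => H v (nth v (port v) q) (index (nth v (port v) q) (port v)))).
  rewrite -(big_nth v xpredT (fun w => H v w (index w (port v)))) big_uniq //.
  by apply: eq_bigl => w; rewrite mpv.
by move=> p _ /=; rewrite ltn_ord index_uniq.
Qed.

(** Each edge once, directed away from the end that draws its colour. *)
Definition arcs : {set V * V} := [set a | e a.1 a.2 && (id a.2 < id a.1)%N].

Lemma symgraph_arcs : symgraph arcs =2 e.
Proof.
move=> v w; rewrite /symgraph !inE /= (esym w v) -andb_orr.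
case: (boolP (e v w)) => //= vw; rewrite orbC -neq_ltn.
by apply/eqP => /id_inj E; move: vw; rewrite E eirr.
Qed.

Definition class_edges omega c : {set V * V} :=
  [set a in arcs | prefix omega a.1 (index a.2 (port a.1)) == c].

Lemma class_edges_sub omega c : class_edges omega c \subset arcs.
Proof. by apply/subsetP => a; rewrite inE => /andP[]. Qed.

(** The event is a conjunction of one condition per arc, and distinct arcs read distinct blocks; so
    its probability factorises, with absence probability 1 - 2^-l per arc. *)
Lemma mean_class_edges_eq c B : size c = l -> B \subset arcs ->
  mean (fun omega => (class_edges omega c == B)%:R)
  = weight arcs (1 - (2 ^+ l)^-1) B.
Proof.
move=> cl BE; pose H v w (y : seq bool) : R :=
  if (id w < id v)%N then ((y == c) == ((v, w) \in B))%:R else 1.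
pose G v p y : R := if (p < size (port v))%N then H v (nth v (port v) p) y else 1.
have arcsE (F : V * V -> R) :
    \prod_(a : V * V | e a.1 a.2) (if (id a.2 < id a.1)%N then F a else 1)
    = \prod_(a in arcs) F a.
  by rewrite -big_mkcondr; apply: eq_bigl => a; rewrite inE.
transitivity (mean (fun omega =>
    \prod_v \prod_(p < N v) G v p (take l (block b p (omega v))))).
  congr (_ / _); apply: eq_bigr => omega _; rewrite /G.
  rewrite (prod_arcs (fun v w p => H v w (prefix omega v p))) /H arcsE prodr_bool.
  congr (nat_of_bool _)%:R; apply/eqP/forall_inP => [<- [v w] aE|all].
    by rewrite inE aE.
  apply/setP => a; rewrite inE; case: (boolP (a \in arcs)) => [aE|aE] /=.
    by have /eqP := all a aE; rewrite -surjective_pairing.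
  by symmetry; apply/negbTE; apply: contra aE; apply: (subsetP BE).
rewrite mean_blocks //.
transitivity (\prod_v \prod_(p < N v)
  (if (p < size (port v))%N then
     if (id (nth v (port v) p) < id v)%N then
       if (v, nth v (port v) p) \in B then (2 ^+ l)^-1 else 1 - (2 ^+ l)^-1 : R
     else 1 else 1)).
  apply: eq_bigr => v _; apply: eq_bigr => p _; rewrite /G /H.
  case: ifP => _; last by rewrite bits_mean_const.
  case: ifP => _; last by rewrite bits_mean_const.
  case: ifP => _.
    have := bits_mean_eq (R := R) 1 0 cl; rewrite mulr1 mulr0 addr0 => <-.
    by rewrite /bits_mean; congr (_ * _); apply: eq_bigr => y _; case: (_ == c).
  have := bits_mean_eq (R := R) 0 1 cl; rewrite mulr1 mulr0 add0r => <-.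
  by rewrite /bits_mean; congr (_ * _); apply: eq_bigr => y _; case: (_ == c).
rewrite (prod_arcs (fun v w _ => if (id w < id v)%N then
  if (v, w) \in B then (2 ^+ l)^-1 else 1 - (2 ^+ l)^-1 : R else 1)).
rewrite (arcsE (fun a => if (a.1, a.2) \in B then (2 ^+ l)^-1 else 1 - (2 ^+ l)^-1)).
rewrite (bigID (mem B)) /= /weight mulrC -!prodr_const; congr (_ * _).
  apply: eq_big => a; first by rewrite in_setD andbC.
  by rewrite -surjective_pairing => /andP[_ /negPf->].
apply: eq_big => a.
  by case: (boolP (a \in B)) => [/(subsetP BE)->|]; rewrite ?andbF.
by rewrite -surjective_pairing => /andP[_ ->]; rewrite opprB addrC subrK.
Qed.

Lemma mean_class_edges c (P : pred {set V * V}) : size c = l ->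
  mean (fun omega => (P (class_edges omega c))%:R)
  = \sum_(B : {set V * V} | (B \subset arcs) && P B)
      weight arcs (1 - (2 ^+ l)^-1) B.
Proof.
move=> cl.
rewrite (eq_bigr (fun B => mean (fun omega => (class_edges omega c == B)%:R))).
  rewrite -mean_sum; congr (_ / _); apply: eq_bigr => omega _.
  case: (boolP (P _)) => PA.
    rewrite (bigD1 (class_edges omega c)) /= ?class_edges_sub // eqxx big1 ?addr0 //.
    by move=> B /andP[_ /negPf]; rewrite eq_sym => ->.
  rewrite big1 // => B /andP[_ PB]; case: eqP => // E.
  by move: PA; rewrite E PB.
by move=> B /andP[BE _]; rewrite mean_class_edges_eq.
Qed.

Definition class_load omega c : nat :=
  size [seq x <- all_items (K := K) omega | take l x.1 == c].

(** Merging equal items only lowers the load, so 2^load is at most a product over messages of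
    independent factors, each 2 with probability 2^-l and 1 otherwise. *)
Lemma mean_class_load c : size c = l ->
  mean (fun omega => 2 ^+ class_load omega c)
  <= (1 + (2 ^+ l)^-1) ^+ (\sum_v size (msgs v)).
Proof.
move=> cl; pose G (v : V) (p : nat) (y : seq bool) : R :=
  if (p < size (port v))%N then 1 else if y == c then 2 else 1.
apply: (@le_trans _ _ (mean (fun omega =>
    \prod_v \prod_(p < N v) G v p (take l (block b p (omega v)))))).
  apply: mean_le => omega; rewrite /class_load /all_items filter_flatten.
  rewrite size_flatten /shape -2!map_comp sumnE big_map big_enum /=.
  rewrite -[X in 2 ^+ X]/(\sum_v _)%N expr_sum.
  apply: ler_prod => v _; rewrite exprn_ge0 //=.
  rewrite big_split_ord /= big1 ?mul1r => [|p _]; last by rewrite /G ltn_ord.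
  rewrite /own_items filter_undup.
  set s := map _ _; apply: (@le_trans _ _ (2 ^+ size [seq x <- s | take l x.1 == c])).
    by apply: ler_weXn2l; [rewrite ler1n | exact: size_undup].
  have -> (s' : seq item) : 2 ^+ size [seq x <- s' | take l x.1 == c]
      = \prod_(x <- s') (if take l x.1 == c then 2 else 1) :> R.
    elim: s' => [|x s' IH]; first by rewrite big_nil.
    by rewrite big_cons -IH /=; case: ifP => _; rewrite ?mul1r //= exprS.
  rewrite big_map -[X in iota 0 X]subn0 -/(index_iota _ _) big_mkord.
  apply: ler_prod => j _ /=; rewrite /G ltnNge leq_addr /=.
  by case: ifP => _; rewrite lexx andbT ?ler01 ?ler0n.
rewrite mean_blocks // expr_sum; apply: ler_prod => v _.
rewrite big_split_ord /= big1 ?mul1r => [|p _]; last first.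
  by rewrite /G ltn_ord bits_mean_const.
rewrite (eq_bigr (fun=> 1 + (2 ^+ l)^-1)) ?prodr_const ?card_ord.
  by rewrite lexx andbT exprn_ge0 // addr_ge0 ?invr_ge0 ?exprn_ge0.
move=> j _; rewrite /G ltnNge leq_addr /= bits_mean_eq //; ring.
Qed.

Definition good (a : nat) omega : bool :=
  [forall c : l.-tuple bool, [&& (#|components (class_edges omega c)| <= 1)%N,
     ~~ nonexpanding del (class_edges omega c) & (class_load omega c <= a)%N]].

Hypothesis econn : connected_graph e.
Hypothesis V2 : (1 < #|V|)%N.
Hypothesis cuts :
  forall S : {set V}, S != set0 -> S != setT -> (lam <= cut_size e S)%N.
Hypothesis degrees : forall v, (del <= degree e v)%N.
Local Notation n := (#|V|%:R : R).
Let q : R := 1 - (2 ^+ l)^-1.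

(** A union bound over the 2^l classes and three kinds of failure; overload is bounded by Markov's
    inequality for 2^load. *)
Lemma mean_bad_le a h : (forall s, 4 * s <= del -> h + 2 * s <= del)%N ->
  n ^+ 3 * q ^+ h <= 2^-1 ->
  mean (fun omega => (~~ good a omega)%:R) <= 2 ^+ l *
   ((if l == 0%N then 0 else n * q ^+ lam./2) + 8 * (n ^+ 3 * q ^+ h)
    + (1 + (2 ^+ l)^-1) ^+ (\sum_v size (msgs v)) / 2 ^+ a.+1).
Proof.
move=> hdel nq.
have [x0 _] : exists x0 : V, x0 \in V by apply/card_gt0P; apply: ltnW.
have L1 : 1 <= 2 ^+ l :> R by rewrite exprn_ege1 // ler1n.
have q0 : 0 <= q by rewrite subr_ge0 invf_le1 // (lt_le_trans ltr01).
have q1 : q <= 1 by rewrite gerBl invr_ge0 (le_trans ler01).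
have symE : symgraph arcs =2 e := symgraph_arcs.
apply: (@le_trans _ _ (mean (fun omega => \sum_(c : l.-tuple bool | true)
  ((1 < #|components (class_edges omega c)|)%N%:R
   + ((nonexpanding del (class_edges omega c))%:R
      + (2 ^+ a.+1)^-1 * 2 ^+ class_load omega c))))).
  apply: mean_le => omega.
  have pos (c : l.-tuple bool) : 0 <= (1 < #|components (class_edges omega c)|)%N%:R
   + ((nonexpanding del (class_edges omega c))%:R
      + (2 ^+ a.+1)^-1 * 2 ^+ class_load omega c) :> R.
    by rewrite !addr_ge0 ?mulr_ge0 ?invr_ge0 ?exprn_ge0 ?ler0n.
  case: (boolP (good a omega)) => [_|]; first by rewrite sumr_ge0.
  rewrite negb_forall => /existsP[c bad]; rewrite (bigD1 c) //=.
  apply: ler_wpDr; first by rewrite sumr_ge0.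
  have load0 : 0 <= (2 ^+ a.+1)^-1 * 2 ^+ class_load omega c :> R.
    by rewrite mulr_ge0 ?invr_ge0 ?exprn_ge0.
  move: bad; rewrite !negb_and negbK -ltnNge => /or3P[->|->|].
  - by rewrite ler_wpDr ?addr_ge0 ?ler0n.
  - by rewrite ler_wpDl ?ler_wpDr ?ler0n.
  rewrite -ltnNge => lt; rewrite !ler_wpDl ?ler0n //.
  by rewrite mulrC ler_pdivlMr ?exprn_gt0 // mul1r ler_weXn2l ?ler1n.
rewrite mean_sum.
have term (c : l.-tuple bool) : mean (fun omega =>
   ((1 < #|components (class_edges omega c)|)%N%:R
   + ((nonexpanding del (class_edges omega c))%:R
      + (2 ^+ a.+1)^-1 * 2 ^+ class_load omega c)))
   <= (if l == 0%N then 0 else n * q ^+ lam./2) + 8 * (n ^+ 3 * q ^+ h)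
    + (1 + (2 ^+ l)^-1) ^+ (\sum_v size (msgs v)) / 2 ^+ a.+1.
  have cl : size c = l by rewrite size_tuple.
  have meanD (f g : space -> R) : mean (fun omega => f omega + g omega) = mean f + mean g.
    by rewrite /mean big_split mulrDl.
  rewrite !meanD meanZ -addrA; apply: lerD; last apply: lerD.
  - rewrite (mean_class_edges (fun B => 1 < #|components B|)%N cl) -/q.
    (* A single class contains every edge and is connected outright; [disconnected_weight] would
       require q > 0. *)
    case: eqP => [l0|/eqP l0].
      rewrite big1 // => B /andP[BE c1]; rewrite /weight -/q.
      have -> : q = 0 by rewrite /q l0 expr0 invr1 subrr.
      rewrite expr0n cards_eq0; case: eqP => [/eqP|_]; last by rewrite mul0r.
      rewrite setD_eq0 => EB; move: c1; have -> : B = arcs by apply/eqP; rewrite eqEsubset BE.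
      rewrite ltnNge => /negP; case.
      apply/card_le1_eqP => S1 S2 /imsetP[x _ ->] /imsetP[y _ ->].
      symmetry; apply: component_eq; rewrite inE.
      by rewrite (eq_connect symE).
    apply: disconnected_weight => //.
      rewrite subr_gt0 invf_lt1 ?exprn_gt0 // exprn_egt1 ?ltr1n //.
    move=> S S0 ST; rewrite /cut_size (eq_card (B := [pred p |
      [&& p.1 \in S, p.2 \notin S & e p.1 p.2]])).
      exact: cuts.
    by move=> p; rewrite !unfold_in symE.
  - rewrite (mean_class_edges (nonexpanding del) cl) -/q.
    apply: le_trans (nonexpanding_weight x0 q0 q1 _ hdel) _.
      move=> v; rewrite cardsE (eq_card (B := [pred w | e v w])) => [|w].
        exact: degrees.
      exact: symE.
    apply: nonexpanding_bound => //; [exact: ltnW | by rewrite exprn_ge0].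
  - by rewrite mulrC ler_wpM2r ?invr_ge0 ?exprn_ge0 // mean_class_load.
apply: le_trans.
  by apply: ler_sum => c _; exact: term c.
by rewrite sumr_const card_tuple card_bool -[leLHS]mulr_natl natrX.
Qed.

End Randomness.

Local Open Scope nat_scope.

Lemma eq_ball (V : finType) (h h' : rel V) u r : h =2 h' -> ball h u r = ball h' u r.
Proof.
move=> hh'; elim: r => [|r IH] //; rewrite !ballS IH /neighbourhood.
congr (_ :|: _); apply/setP => w; rewrite !inE.
by apply: eq_existsb => v; rewrite hh'.
Qed.

(** * Cuts and degrees *)

Section Graphs.
Variables (V : finType) (e : rel V).
Hypotheses (esym : symmetric e) (eirr : irreflexive e).
Hypotheses (econn : connected_graph e) (V2 : 1 < #|V|).

Lemma edge_connectivity_le S : S != set0 -> S != setT ->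
  edge_connectivity e <= cut_size e S.
Proof.
move=> S0 ST; rewrite /edge_connectivity -minEnat -leEnat.
by apply: bigmin_le_cond; rewrite S0 ST.
Qed.

Lemma min_degree_le v : min_degree e <= degree e v.
Proof. by rewrite /min_degree -minEnat -leEnat; apply: bigmin_le_cond. Qed.

Lemma edge_connectivity_gt0 : 0 < edge_connectivity e.
Proof.
rewrite /edge_connectivity; apply: (big_ind (fun x => 0 < x)).
- by rewrite expn_gt0 ltnW.
- by move=> x y x0 y0; rewrite leq_min x0.
move=> S /andP[/set0Pn[x xS] ST].
have [y yS] : exists y, y \notin S.
  apply/existsP; rewrite -negb_forall; apply: contra ST => /forallP all.
  by apply/eqP/setP => z; rewrite inE all.
rewrite lt0n; apply/negP => /eqP/card0_eq cut0; move: yS.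
case/connectP: (econn x y) => p; elim: p x xS => [|z p IH] x xS /=.
  by move=> _ ->; rewrite xS.
case/andP => xz /IH{}IH E; apply: IH => //; apply/negPn/negP => zS.
by have := cut0 (x, z); rewrite unfold_in /= xS zS xz.
Qed.

Lemma edge_connectivity_le_degree v : edge_connectivity e <= degree e v.
Proof.
apply: leq_trans (@edge_connectivity_le [set v] _ _) _.
- by apply/set0Pn; exists v; rewrite inE.
- by apply/eqP => E; have := cardsT V; rewrite -E cards1 => V1; move: V2; rewrite -V1.
rewrite /cut_size /degree.
rewrite -(card_imset (mem [pred w | e v w]) (fun w w' (E : (v, w) = (v, w')) =>
  let: erefl := E in erefl)).
apply: subset_leq_card; apply/subsetP => -[x w]; rewrite unfold_in /= inE.
by case/and3P => /eqP-> _ vw; apply/imsetP; exists w.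
Qed.

Lemma edge_connectivity_le_min_degree : edge_connectivity e <= min_degree e.
Proof.
rewrite /min_degree; apply: (big_ind (fun x => edge_connectivity e <= x)).
(* The default value of the minimum must be bounded below as well. *)
- have [x _] : exists x : V, x \in V by apply/card_gt0P; exact: ltnW.
  exact: leq_trans (edge_connectivity_le_degree x) (max_card _).
- by move=> x y lx ly; rewrite leq_min lx.
- by move=> v _; exact: edge_connectivity_le_degree.
Qed.

Lemma min_degree_le_card : min_degree e <= #|V|.
Proof.
have [x _] : exists x : V, x \in V by apply/card_gt0P; exact: ltnW.
exact: leq_trans (min_degree_le x) (max_card _).
Qed.

End Graphs.

(** * Running time on a good outcome *)

Section GoodExecution.
Variables (K : nat) (V : finType) (e : rel V) (port : V -> seq V) (id : V -> nat).
Variables (msgs : V -> seq bits) (lam del : nat).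
Hypotheses (esym : symmetric e) (eirr : irreflexive e) (econn : connected_graph e).
Hypothesis eport : port_numbering e port.
Hypothesis id_inj : injective id.
Variable l : V.
Hypothesis l_max : forall u, id u <= id l.
Local Notation alg := (broadcast K).
Local Notation plen := (prefix_length K lam (id l)).

(** Expansion makes balls of radius r in each class larger than del / 4, so all classes have
    diameter at most D, and so does the whole graph. *)
Lemma good_broadcast_done a r D (omega : outcome alg port id msgs lam del) :
  plen <= trunc_log 2 lam -> del < 4 * 2 ^ r ->
  good e (id l) a omega ->
  D = (2 * r + 1) * (#|V| %/ (del %/ 4 + 1) + 1) ->
  broadcast_done (8 * D + 2 * a + 8) omega.
Proof.
move=> lb delr gd DE.
have graphE c : class_graph e l omega c =2 symgraph (class_edges e (id l) omega c).
  move=> v w; rewrite /class_graph /symgraph !inE /edge_colour /= (esym w v).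
  case: (boolP (e v w)) => //= vw; case: ltngtP => //= [|E]; rewrite ?orbF //.
  by move: vw; rewrite (id_inj E) eirr.
have conn c : size c = plen -> connected_graph (symgraph (class_edges e (id l) omega c)).
  move=> /eqP cl; apply: connected_components.
  by have /forallP/(_ (Tuple cl))/and3P[] := gd.
have near c (cl : size c = plen) u v : dist (conn c cl) v u <= D.
  rewrite DE; apply: dist_of_ball_growth => [||w]; [exact: symgraph_sym | by rewrite addn1|].
  have cl' : size c == plen by apply/eqP.
  have /forallP/(_ (Tuple cl'))/and3P[_ nx _] := gd.
  have : del < 4 * #|ball (symgraph (class_edges e (id l) omega c)) w r|.
    apply: card_ball_expanding delr => X X0 X4; rewrite leqNgt.
    apply: contra nx => X2; apply/existsP; exists X; exact/and3P.
  by move: (#|ball _ _ _|) => x; lia.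
have rhoD : eccentricity econn l <= D.
  apply/bigmax_leqP => v _; have cl : size (nseq plen false) = plen by rewrite size_nseq.
  apply: leq_trans (near _ cl v l); apply: dist_subrel => x y.
  by rewrite -graphE => /andP[].
apply: (broadcast_done_after esym (econn := econn) eport id_inj l_max
  (D := D) (a := a) lb).
- move=> c cl u v; rewrite (eq_ball _ _ (graphE c)) (distP (conn c cl)).
  exact: near.
- move=> c /eqP cl.
  by have /forallP/(_ (Tuple cl))/and3P[] := gd.
(* Election takes 5 rho + 2 rounds, flooding D + 2 a + 2 and the countdown 2 rho + 2, where rho <=
   D; the total is at most 8 D + 2 a + 6. *)
- rewrite /span; lia.
Qed.

End GoodExecution.

Local Open Scope ring_scope.

(** * Numerical estimates *)

Section Estimates.
Variable R : realType.

Lemma ln2_ge : 2^-1 <= ln 2 :> R.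
Proof.
rewrite -[leLHS]expRK ler_ln ?posrE ?expR_gt0 //.
apply: le_trans (expR_le_inv _) _; first by lra.
by rewrite (_ : 1 - 2^-1 = 2^-1 :> R) ?invrK //; lra.
Qed.

Lemma trunc_log_le_ln n : (0 < n)%N -> (trunc_log 2 n)%:R <= 2 * ln n%:R :> R.
Proof.
move=> n0.
have : ln (2 ^+ trunc_log 2 n : R) <= ln n%:R.
  by rewrite ler_ln ?posrE ?exprn_gt0 ?ltr0n // -natrX ler_nat trunc_logP.
rewrite lnXn // -[_ *+ trunc_log 2 n]mulr_natr => le.
have := ler_wpM2r (ler0n R (trunc_log 2 n)) ln2_ge; lra.
Qed.

Lemma one_le_ln n : (1 < n)%N -> 1 <= 2 * ln n%:R :> R.
Proof.
move=> n1; have : ln (2 : R) <= ln n%:R.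
  by rewrite ler_ln ?posrE ?ltr0n ?ler_nat // ltnW.
by have := ln2_ge; lra.
Qed.

Lemma half_pow_le (L j : nat) : (0 < L)%N ->
  (1 - L%:R^-1) ^+ (L * j) <= 2^-1 ^+ j :> R.
Proof.
move=> L0; have L1 : L%:R^-1 <= 1 :> R by rewrite invf_le1 ?ltr0n // ler1n.
rewrite exprM lerXn2r ?nnegrE ?exprn_ge0 ?subr_ge0 ?invr_ge0 //.
apply: le_trans (@expRm1_le R).
have -> : -1 = L%:R * - L%:R^-1 :> R by rewrite mulrN mulfV // pnatr_eq0 -lt0n.
rewrite expRM_natl lerXn2r ?nnegrE ?expR_ge0 ?subr_ge0 //.
exact: expR_ge1Dx.
Qed.

(** The numerator is at most e^(k / L), hence at most 4^(kap + 1) with kap = [k %/ L]; the exponent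
    of the denominator exceeds 2 kap + 2 by more than j. *)
Lemma load_bound (L k j : nat) : (0 < L)%N ->
  (1 + L%:R^-1) ^+ k / 2 ^+ (2 * (k %/ L) + 2 + j).+1 <= 2^-1 ^+ j :> R.
Proof.
move=> L0; set kap := (k %/ L)%N.
have le1 : (1 + L%:R^-1) ^+ k <= 2 ^+ (2 * (kap + 1)) :> R.
  apply: le_trans (exp1Dx_le _ _) _; first by rewrite invr_ge0.
  apply: (@le_trans _ _ (expR ((kap + 1)%:R * 1))).
    rewrite ler_expR mulr1 ler_pdivrMr ?ltr0n // -natrM ler_nat addn1.
    by rewrite ltnW // ltn_ceil.
  rewrite expRM_natl exprM lerXn2r ?nnegrE ?expR_ge0 ?exprn_ge0 //.
  by apply: le_trans (@expR1_le4 R) _; rewrite expr2; lra.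
rewrite ler_pdivrMr ?exprn_gt0 //.
apply: le_trans le1 _.
have -> : (2 * kap + 2 + j).+1 = (j + (2 * (kap + 1)).+1)%N by lia.
rewrite exprD mulrA -exprMn mulVf ?pnatr_eq0 // expr1n mul1r.
by rewrite ler_weXn2l ?ler1n.
Qed.

End Estimates.

Section Final.
Variable R : realType.

Lemma leader_exists (V : finType) (id : V -> nat) : (0 < #|V|)%N ->
  exists l, forall u, (id u <= id l)%N.
Proof.
case/card_gt0P => x _; exists [arg max_(u > x) id u]%N.
by case: arg_maxnP => // l _ le u; apply: le.
Qed.

Lemma card_le_max_id (V : finType) (id : V -> nat) M : injective id ->
  (forall v, 1 <= id v <= M)%N -> (#|V| <= M)%N.
Proof.
move=> inj idM; rewrite cardE -(size_map id) -(size_iota 1 M).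
apply: uniq_leq_size; first by rewrite map_inj_uniq ?enum_uniq.
by move=> _ /mapP[v _ ->]; rewrite mem_iota add1n ltnS.
Qed.

Lemma max_size_le (V : finType) (msgs : V -> seq bits) (x : R) : 0 <= x ->
  (forall v z, z \in msgs v -> (size z)%:R <= x) ->
  exists2 mu : nat, (forall v z, z \in msgs v -> (size z <= mu)%N) & mu%:R <= x.
Proof.
move=> x0 hx; exists (\max_v \max_(z <- msgs v) size z)%N.
  move=> v z zv; apply: leq_trans (leq_bigmax v).
  exact: leq_bigmax_seq.
have maxP i j : i%:R <= x -> j%:R <= x -> (maxn i j)%:R <= x.
  by rewrite /maxn; case: ifP.
apply: (big_ind (fun i : nat => i%:R <= x)) => // v _.
rewrite big_seq; apply: (big_ind (fun i : nat => i%:R <= x)) => // z.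
exact: hx.
Qed.

(* q stands for log2 M + 1, L for the number of classes, D for their diameter
   and a for their load. *)
Lemma rounds_le (n del lam k q L Kc d D a : nat) :
  (0 < n)%N -> (0 < del)%N -> (0 < lam)%N -> (0 < q)%N -> (0 < L)%N ->
  (del <= n)%N -> (lam <= 2 * (Kc * q * L))%N ->
  D = ((2 * q + 1) * (n %/ (del %/ 4 + 1) + 1))%N ->
  a = (2 * (k %/ L) + 2 + d * q)%N ->
  (8 * D + 2 * a + 8)%:R
  <= (132 + 2 * d + 8 * Kc)%:R * q%:R * (n%:R / del%:R + k%:R / lam%:R) :> R.
Proof.
move=> n0 del0 lam0 q0 L0 deln lamL DE aE.
set x := n%:R / del%:R; set y := k%:R / lam%:R.
have x1 : 1 <= x by rewrite ler_pdivlMr ?ltr0n // mul1r ler_nat.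
have y0 : 0 <= y by rewrite divr_ge0.
have q1 : 1 <= q%:R :> R by rewrite ler1n.
have gx : (n %/ (del %/ 4 + 1))%:R <= 4 * x.
  rewrite /x mulrA ler_pdivlMr ?ltr0n // -!natrM ler_nat.
  have := leq_trunc_div n (del %/ 4 + 1); nia.
have Dx : D%:R <= 3 * q%:R * (5 * x).
  rewrite DE natrM; apply: ler_pM; rewrite ?ler0n //.
    by rewrite natrD natrM; lra.
  by rewrite natrD; lra.
have ky : (k %/ L)%:R <= 2 * Kc%:R * q%:R * y.
  rewrite /y mulrA ler_pdivlMr ?ltr0n // -!natrM ler_nat.
  have := leq_trunc_div k L; nia.
have qx : q%:R <= q%:R * x by rewrite ler_peMr.
have dq : d%:R * q%:R <= d%:R * (q%:R * x) by rewrite ler_wpM2l.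
have Kx : 0 <= Kc%:R * (q%:R * x).
  by apply: mulr_ge0 => //; apply: mulr_ge0 => //; lra.
have qy : 0 <= q%:R * y by apply: mulr_ge0.
have dy : 0 <= d%:R * (q%:R * y) by apply: mulr_ge0.
(* The part 8 D costs 120 q x, the additive constants 12 q x, and 2 a the rest, 2 d q x + 8 Kc q y;
   this gives 132 = 120 + 12. *)
rewrite aE !natrD !natrM; lra.
Qed.

Lemma uphalf_add_double del s : (4 * s <= del)%N -> (uphalf del + 2 * s <= del)%N.
Proof. lia. Qed.

Lemma half_le_uphalf m n : (m <= n)%N -> (m./2 <= uphalf n)%N.
Proof. lia. Qed.

(** Here N is the number of nodes, w = 1 / N, and x the number of classes. The surplus powers of w
    absorb the factor x and the constants. *)
Lemma failure_sum_le (N w x A B C : R) d : 0 < w -> w <= 2^-1 -> N * w = 1 ->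
  0 <= x -> x <= N -> 0 <= A -> 0 <= B -> 0 <= C ->
  A <= w ^+ (d + 9) -> B <= w ^+ (d + 7) -> C <= w ^+ (d + 3) ->
  x * (A + 8 * B + C) <= w ^+ d.
Proof.
move=> w0 w2 Nw x0 xN A0 B0 C0; rewrite !exprD => hA hB hC.
have wd : 0 <= w ^+ d by rewrite exprn_ge0 // ltW.
move: (w ^+ d) wd hA hB hC => z z0 hA hB hC.
have pw j : w ^+ j.+1 <= 2^-1 * w ^+ j.
  by rewrite exprS ler_wpM2r // exprn_ge0 // ltW.
have w3 : 0 <= w ^+ 3 by rewrite exprn_ge0 // ltW.
have p3 := pw 3; have p4 := pw 4; have p5 := pw 5.
have p6 := pw 6; have p7 := pw 7; have p8 := pw 8.
have sum : A + 8 * B + C <= z * (4 * w ^+ 3).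
  have e9 : z * w ^+ 9 <= z * w ^+ 3 by rewrite ler_wpM2l //; lra.
  have e7 : 8 * (z * w ^+ 7) <= z * w ^+ 3.
    by rewrite mulrCA ler_wpM2l //; lra.
  by rewrite mulrCA; lra.
apply: (@le_trans _ _ (N * (z * (4 * w ^+ 3)))).
  by apply: ler_pM => //; rewrite !addr_ge0 // mulr_ge0.
have -> : N * (z * (4 * w ^+ 3)) = z * (4 * w ^+ 2).
  rewrite (_ : N * (z * (4 * w ^+ 3)) = (N * w) * (z * (4 * w ^+ 2))); first by rewrite Nw mul1r.
  by rewrite exprS; ring.
rewrite -[leRHS]mulr1 ler_wpM2l //.
have := pw 1; rewrite expr1; lra.
Qed.

End Final.

Theorem theorem1 (R : realType) (c m d : nat) (c_ge1 : (1 <= c)%N) :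
  exists (A : algorithm) (B C : nat),
  forall (V : finType) (e : rel V) (n lambda delta k : nat)
         (port : V -> seq V) (id : V -> nat) (msgs : V -> seq bits),
    n = #|V| -> (1 < n)%N ->
    symmetric e -> irreflexive e -> connected_graph e ->
    lambda = edge_connectivity e -> delta = min_degree e ->
    port_numbering e port ->
    injective id -> (forall v, (1 <= id v <= n ^ c)%N) ->
    k = (\sum_(v : V) size (msgs v))%N ->
    (forall v x, x \in msgs v -> (size x)%:R <= m%:R * ln n%:R :> R) ->
    respects_bandwidth A port id msgs lambda delta (B%:R * ln n%:R : R) /\
    exists T : nat,
      T%:R <= C%:R * (n%:R * ln n%:R / delta%:R + k%:R * ln n%:R / lambda%:R)
        :> R /\
      1 - (n%:R ^+ d)^-1 <=
        probability_done A port id msgs lambda delta R T.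

Proof.
(* With several classes, lam / 2 is then at least L (d + 10) q, so an absence probability of 1 - 1 /
   L raised to the power lam / 2 is at most n^-(d + 10). *)
pose K := (2 * (d + 10))%N.
(* The bandwidth follows from [encode_le] with log2 n <= 2 ln n, the constant 14 being at most 28 ln
   n. The round constant is that of [rounds_le] times 2 c + 2, since q <= (2 c + 2) ln n. *)
exists (broadcast K), (4 * c + 44 + 2 * m)%N,
  ((2 * c + 2) * (132 + 2 * (d + 3) + 8 * K))%N.
move=> V e n lam del k port id msgs nE n2 esym eirr econn lamE delE eport id_inj
  id_le kE msgs_le.
have ln1 := one_le_ln R n2; set lnn := ln n%:R in ln1 *.
have n0 : (0 < n)%N by apply: ltnW.
have V2 : (1 < #|V|)%N by rewrite -nE.
have [l l_max] : exists l, forall u, (id u <= id l)%N.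
  by apply: leader_exists; rewrite -nE.
have Mn : (n <= id l)%N.
  rewrite nE; apply: (card_le_max_id id_inj) => v.
  by rewrite l_max andbT; have /andP[] := id_le v.
have M0 : (0 < id l)%N := leq_trans n0 Mn.
have lam0 : (0 < lam)%N by rewrite lamE edge_connectivity_gt0.
have lamdel : (lam <= del)%N by rewrite lamE delE edge_connectivity_le_min_degree.
have deln : (del <= n)%N by rewrite nE delE min_degree_le_card.
have lamn : (lam <= n)%N := leq_trans lamdel deln.
have tlM : (trunc_log 2 (id l))%:R <= 2 * c%:R * lnn.
  apply: le_trans (trunc_log_le_ln R M0) _; rewrite -mulrA ler_wpM2l //.
  rewrite mulr_natl -lnXn ?ltr0n // ler_ln ?posrE ?ltr0n ?exprn_gt0 ?ltr0n //.
  by rewrite -natrX ler_nat; have /andP[] := id_le l.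
split.
  move=> omega t v p plt.
  have [mu mu_le mux] := max_size_le (x := m%:R * lnn)
    ltac:(rewrite mulr_ge0 //; lra) msgs_le.
  have := message_sent_le esym econn eport id_inj l_max omega t v p mu_le.
  rewrite -(ler_nat R) => /le_trans; apply.
  have tln := trunc_log_le_ln R n0; rewrite -/lnn in tln.
  have t2n : (trunc_log 2 (2 * n))%:R = (trunc_log 2 n)%:R + 1 :> R.
    by rewrite natr1 mul2n trunc_log2_double.
  have tlam : (trunc_log 2 lam)%:R <= 2 * lnn.
    by apply: le_trans tln; rewrite ler_nat leq_trunc_log.
  rewrite -nE !(natrD, natrM) t2n; lra.
set q := (trunc_log 2 (id l)).+1.
have nq : (n < 2 ^ q)%N.
  by apply: leq_ltn_trans Mn _; rewrite trunc_log_ltn.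
set pl := prefix_length K lam (id l); pose L := (2 ^ pl)%N.
have L0 : (0 < L)%N by rewrite expn_gt0.
have plE : pl = trunc_log 2 (lam %/ (K * q)) by [].
have Kq0 : (0 < K * q)%N by rewrite muln_gt0 /K muln_gt0 addn_gt0 orbT.
have lamL : (lam <= 2 * (K * q * L))%N.
  apply: ltnW; apply: leq_trans (ltn_ceil lam Kq0) _.
  have le2 : ((lam %/ (K * q)).+1 <= 2 * L)%N by rewrite /L -expnS plE trunc_log_ltn.
  by apply: leq_trans (leq_mul le2 (leqnn _)) _; rewrite -mulnA (mulnC L).
(* If lam < K q, the quotient vanishes and there is just one class. *)
have Lcase : pl = 0%N \/ (L * (K * q) <= lam)%N.
  have [z|d0] := posnP (lam %/ (K * q)); first by left; rewrite plE z.
  right; apply: leq_trans (leq_trunc_div lam (K * q)).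
  by rewrite leq_mul2r /L plE trunc_logP ?orbT.
have plb : (pl <= trunc_log 2 lam)%N.
  by rewrite plE leq_trunc_log // leq_div.
have Ln : (L <= n)%N.
  case: Lcase => [pl0|le]; first by rewrite /L pl0.
  by apply: leq_trans lamn; apply: leq_trans le; rewrite leq_pmulr.
(* Radius q suffices for the growth of balls, as 2^q > n >= del. The extra load (d + 3) q below
   makes overload as rare as n^-(d + 3) per class. *)
pose D := ((2 * q + 1) * (n %/ (del %/ 4 + 1) + 1))%N.
pose a := (2 * (k %/ L) + 2 + (d + 3) * q)%N.
exists (8 * D + 2 * a + 8)%N; split.
  apply: le_trans (rounds_le R n0 _ lam0 (ltn0Sn _) L0 deln lamL erefl erefl) _.
    exact: leq_trans lam0 lamdel.
  have ql : q%:R <= (2 * c + 2)%:R * lnn.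
    have -> : q%:R = (trunc_log 2 (id l))%:R + 1 :> R by rewrite natr1.
    by rewrite natrD natrM; move: tlM; lra.
  rewrite [in leRHS]natrM -[n%:R * _ / _]mulrA -[k%:R * _ / _]mulrA.
  rewrite ![lnn * _^-1]mulrC ![_ * (_ * lnn)]mulrA -mulrDl.
  set z := _ + _; have z0 : 0 <= z by rewrite addr_ge0 ?divr_ge0.
  rewrite [leRHS](_ : _ = (132 + 2 * (d + 3) + 8 * K)%:R * ((2 * c + 2)%:R * lnn) * z).
    by rewrite ler_wpM2r // ler_wpM2l.
  by rewrite mulrA [in RHS]mulrA; ring.
have del1 : (del < 4 * 2 ^ q)%N by lia.
pose w : R := n%:R^-1.
have w0 : 0 < w by rewrite invr_gt0 ltr0n.
have w2 : w <= 2^-1 by rewrite lef_pV2 ?posrE ?ltr0n // ler_nat.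
have wq j : 2^-1 ^+ (j * q) <= w ^+ j :> R.
  rewrite mulnC exprM lerXn2r ?nnegrE ?exprn_ge0 ?invr_ge0 ?(ltW w0) //.
  by rewrite exprVn lef_pV2 ?posrE ?ltr0n ?exprn_gt0 // -natrX ler_nat ltnW.
have nw j : n%:R * w ^+ j.+1 = w ^+ j.
  by rewrite exprS mulrA mulfV ?mul1r // pnatr_eq0 -lt0n.
pose Q : R := 1 - (2 ^+ pl)^-1.
have QE : Q = 1 - L%:R^-1 by rewrite /Q /L natrX.
have Q0 : 0 <= Q by rewrite QE subr_ge0 invf_le1 ?ltr0n // ler1n.
have Q1 : Q <= 1 by rewrite QE gerBl invr_ge0.
have Qpow h : (lam./2 <= h)%N -> pl != 0%N -> Q ^+ h <= w ^+ (d + 10).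
  case: Lcase => [->//|le] lamh _; apply: le_trans (wq (d + 10)%N).
  apply: le_trans (half_pow_le R ((d + 10) * q) L0); rewrite -QE ler_wiXn2l //.
  apply: leq_trans lamh; rewrite -[X in (X <= _)%N]doubleK half_leq //.
  by apply: leq_trans le; rewrite /K -muln2; nia.
(* If 4 s <= del, then 2 s is at most half of del; and h is at least lam / 2, so [Qpow] applies to
   it. *)
pose h := uphalf del.
have h0 : (0 < h)%N by rewrite uphalf_gt0 (leq_trans lam0 lamdel).
have Qh : Q ^+ h <= w ^+ (d + 10).
  (* For a single class Q = 0, and h > 0 makes the power vanish. *)
  have [pl0|] := eqVneq pl 0%N; last exact: Qpow (half_le_uphalf lamdel).
  have -> : Q = 0 by rewrite /Q pl0 expr0 invr1 subrr.
  by rewrite expr0n gtn_eqF // exprn_ge0 // ltW.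
have n3 : n%:R ^+ 3 * Q ^+ h <= w ^+ (d + 7).
  apply: le_trans (ler_wpM2l (exprn_ge0 3 (ler0n R n)) Qh) _.
  by rewrite !exprS expr0 mulr1 -[(d + 10)%N]/(d + (7 + 3))%N addnA !addnS addn0 -!mulrA !nw.
pose avg (f : outcome (broadcast K) port id msgs lam del -> R) : R :=
  @mean R V (fun v => (size (port v) + size (msgs v))%N) (trunc_log 2 lam) f.
have bad : avg (fun omega : outcome (broadcast K) port id msgs lam del =>
    (~~ good e (id l) a omega)%:R : R) <= w ^+ d.
  apply: le_trans (mean_bad_le msgs esym eirr eport id_inj plb econn V2 _ _ a
    (h := h) _ _) _; rewrite -?nE -?kE.
  - by move=> S S0 ST; rewrite lamE edge_connectivity_le.
  - by move=> v; rewrite delE min_degree_le.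
  - exact: uphalf_add_double.
  - apply: le_trans n3 _; apply: (le_trans _ w2); rewrite addnS exprS ler_piMr ?(ltW w0) //.
    by rewrite exprn_ile1 ?(ltW w0) // (le_trans w2) // invf_le1 // ler1n.
  rewrite -/pl -/Q.
  have c1 : (if pl == 0%N then 0 else n%:R * Q ^+ lam./2) <= w ^+ (d + 9).
    case: eqP => [_|/eqP pl0]; first by rewrite exprn_ge0 ?ltW.
    by rewrite -nw -addnS ler_wpM2l ?ler0n // Qpow.
  have c3 : (1 + (2 ^+ pl)^-1) ^+ k / 2 ^+ a.+1 <= w ^+ (d + 3) :> R.
    have -> : 2 ^+ pl = L%:R :> R by rewrite /L natrX.
    by apply: le_trans (load_bound R k ((d + 3) * q) L0) _; exact: wq.
  have Ln' : 2 ^+ pl <= n%:R :> R by rewrite -natrX ler_nat.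
  apply: (failure_sum_le (N := n%:R) w0 w2 _ _ Ln' _ _ _ c1 n3 c3).
  - by rewrite mulfV // pnatr_eq0 -lt0n.
  - by rewrite exprn_ge0.
  - by case: ifP => // _; rewrite mulr_ge0 ?exprn_ge0.
  - by rewrite mulr_ge0 ?exprn_ge0.
  - by rewrite divr_ge0 ?exprn_ge0 // addr_ge0 ?invr_ge0 ?exprn_ge0.
rewrite /probability_done.
have -> : #|[pred omega : outcome (broadcast K) port id msgs lam del
      | broadcast_done (8 * D + 2 * a + 8) omega]|%:R
    / #|{: outcome (broadcast K) port id msgs lam del}|%:R
  = avg (fun omega : outcome (broadcast K) port id msgs lam del =>
      (broadcast_done (8 * D + 2 * a + 8) omega)%:R : R).
  by symmetry; apply: mean_pred.
rewrite -exprVn -/w lerBlDr.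
(* Every outcome is either bad or a completed broadcast, so the two means add up to at least 1. *)
apply: (@le_trans _ _ (avg (fun omega : outcome (broadcast K) port id msgs lam del =>
  (broadcast_done (8 * D + 2 * a + 8) omega)%:R
  + (~~ good e (id l) a omega)%:R : R))).
  rewrite -[leLHS](_ : avg (fun=> 1) = 1 :> R).
    apply: mean_le => omega; have [gd|_] := boolP (good _ _ _ _).
      rewrite (good_broadcast_done esym eirr econn eport id_inj l_max plb del1 gd) //.
        by rewrite lerDl.
      by rewrite /D nE.
    by rewrite lerDr.
  by rewrite /avg /mean sumr_const divff // gt_eqF // card_space_gt0.
rewrite {1}/avg /mean big_split mulrDl lerD2l.
exact: bad.
Qed.
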